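(* Let $k$ be a fixed positive integer (not depending on $n$). For each $n$, let $P_n$ be a positive integer and $\mathcal{D}=\mathcal{D}_n$ a probability distribution on $\{1,\ldots,P_n\}$, and consider the general random intersection graph $G(n,P_n,\mathcal{D})$. Let $X$ be a random variable with distribution $\mathcal{D}$ and define $\alpha_n$ by $$\frac{\{\mathbb{E}[X]\}^2}{P_n}=\frac{\ln n+(k-1)\ln\ln n+\alpha_n}{n}.$$ If $\mathbb{E}[X]=\Omega\big((\ln n)^3\big)$, $\mathrm{Var}[X]=o\!\left(\frac{\{\mathbb{E}[X]\}^2}{n(\ln n)^2}\right)$ and $|\alpha_n|=o(\ln n)$, then $$\lim_{n\to\infty}\mathbb{P}[G(n,P_n,\mathcal{D})\text{ is }k\text{-robust}]=\begin{cases}0,&\text{if }\lim_{n\to\infty}\alpha_n=-\infty,\\ 1,&\text{if }\lim_{n\to\infty}\alpha_n=\infty.\end{cases}$$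
   Context: General random intersection graph $G(n,P_n,\mathcal{D})$: on nodes $v_1,\ldots,v_n$ and an object pool of $P_n$ distinct objects, each node $v_i$ independently receives an object set $S_i$: first $|S_i|$ is drawn from $\mathcal{D}$, then, conditionally on $|S_i|=s_i$, $S_i$ is a uniformly random $s_i$-element subset of the pool. Distinct nodes $v_i,v_j$ are adjacent iff $S_i\cap S_j\neq\emptyset$. A graph with node set $\mathcal{V}$ is $k$-robust if for every nonempty proper subset $T\subsetneq\mathcal{V}$, at least one of the following holds: (a) some node in $T$ has at least $k$ neighbors in $\mathcal{V}\setminus T$; (b) some node in $\mathcal{V}\setminus T$ has at least $k$ neighbors in $T$. All limits and asymptotic notation are as $n\to\infty$. *)

(* Defs.v *)
From HB Require Import structures.
From mathcomp Require Import all_boot all_order all_algebra.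
From mathcomp Require Import all_classical all_reals all_analysis.

Set Implicit Arguments.
Unset Strict Implicit.
Unset Printing Implicit Defensive.

Import Order.TTheory GRing.Theory Num.Theory.
Import numFieldNormedType.Exports.

Local Open Scope ring_scope.

Record size_distr (R : realType) (P : nat) := SizeDistr {
  pmf :> nat -> R;
  pmf_ge0 : forall s, 0 <= pmf s;
  pmf_supp : forall s, ~~ (1 <= s <= P)%N -> pmf s = 0;
  pmf_sum1 : \sum_(1 <= s < P.+1) pmf s = 1 }.

Definition size_mean (R : realType) (P : nat) (D : size_distr R P) : R :=
  \sum_(1 <= s < P.+1) s%:R * D s.

Definition size_var (R : realType) (P : nat) (D : size_distr R P) : R :=
  \sum_(1 <= s < P.+1) (s%:R - size_mean D) ^+ 2 * D s.

(* The law of a single object set: its size is drawn from [D], and given that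
   size [s] it is uniform among the ['C(P, s)] subsets of the pool. *)
Definition objset_prob (R : realType) (P : nat) (D : size_distr R P)
    (A : {set 'I_P}) : R :=
  D #|A| / 'C(P, #|A|)%:R.

(* An outcome [S] lists the object sets of the [n] nodes; independence of the
   nodes is the product weight. *)
Definition rig_prob (R : realType) (n P : nat) (D : size_distr R P)
    (E : pred {ffun 'I_n -> {set 'I_P}}) : R :=
  \sum_(S : {ffun 'I_n -> {set 'I_P}} | E S) \prod_(i < n) objset_prob D (S i).

Definition rig_adj (n P : nat) (S : {ffun 'I_n -> {set 'I_P}}) : rel 'I_n :=
  fun i j => (i != j) && (S i :&: S j != finset.set0).

Definition robust (k : nat) (V : finType) (adj : rel V) : bool :=
  [forall T : {set V}, (T != finset.set0) && (T \proper finset.setT) ==>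
    [exists v in T, (k <= #|[set w in ~: T | adj v w]|)%N]
    || [exists v in ~: T, (k <= #|[set w in T | adj v w]|)%N]].

Definition rig_robust_prob (R : realType) (k n P : nat) (D : size_distr R P)
    : R :=
  rig_prob D (fun S : {ffun 'I_n -> {set 'I_P}} => robust k (rig_adj S)).

Lemma sum_objset_prob (R : realType) (P : nat) (D : size_distr R P) :
  \sum_(A : {set 'I_P}) objset_prob D A = 1.
Proof.
have cardP (A : {set 'I_P}) : (#|A| < P.+1)%N.
  by rewrite ltnS -[X in (_ <= X)%N](card_ord P) max_card.
have sum0 : \sum_(s < P.+1) D s = 1.
  by rewrite -(big_mkord xpredT D) big_nat_recl // pmf_supp // add0r
     -(pmf_sum1 D) big_add1.
rewrite (partition_big (fun A => Ordinal (cardP A)) xpredT) //= -[RHS]sum0.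
apply: eq_bigr => s _.
rewrite (eq_bigr (fun=> D s / 'C(P, s)%:R)); last first.
  by move=> A /eqP <-.
have draws := card_draws 'I_P s.
rewrite card_ord -cardsE in draws.
rewrite sumr_const (_ : #|_| = 'C(P, s)); last first.
  by rewrite -draws; apply: eq_card => A; rewrite !inE.
rewrite -[LHS]mulr_natr mulfVK // pnatr_eq0 -lt0n bin_gt0 -ltnS; exact: ltn_ord.
Qed.

Lemma rig_prob_predT (R : realType) (n P : nat) (D : size_distr R P) :
  rig_prob D (fun _ : {ffun 'I_n -> {set 'I_P}} => true) = 1.
Proof.
rewrite /rig_prob -(bigA_distr_bigA (fun (i : 'I_n) A => objset_prob D A)) /=.
by apply: big1 => i _; exact: sum_objset_prob.
Qed.

(* Main.v *)
Require Import Defs.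
From mathcomp Require Import all_boot all_order all_algebra.
From mathcomp Require Import all_classical all_reals all_analysis.
From mathcomp Require Import ring lra zify.
Set Implicit Arguments.
Unset Strict Implicit.
Unset Printing Implicit Defensive.
Import Order.TTheory GRing.Theory Num.Theory.
Import numFieldNormedType.Exports.
Local Open Scope ring_scope.

(** Write [m = E X], [L = ln n] and [lam = n m^2 / P = L + (k-1) ln L + alpha].
    With high probability all object sets have size [m (1 + o(1/L))] and the
    total overlap [sum_(i <> j) |S_i :&: S_j|] is [o(n m / L)]; call such a
    configuration good. The key device is to condition on the object sets
    outside a set [T] of nodes: the sets inside [T] are then independent, and
    the number of outside neighbours of each is governed by an almost disjoint
    family, hence nearly Poisson of mean [(1 - |T|/n) lam].

    If [alpha -> +oo]: a failure of robustness gives [T] with [1 <= |T| <= n/2]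
    all of whose nodes have fewer than [k] neighbours outside [T]. Conditionally
    on a good outside this has probability at most
    [(C lam^(k-1) exp (- (1 - |T|/n) lam))^|T|], and the union bound over [T]
    is [O(exp (- alpha))].

    If [alpha -> -oo]: robustness forces minimum degree at least [k], and the
    second moment method applies to the nodes sharing at most [k-1] objects
    (with multiplicity) with the others: given the outside, that event is
    hypergeometric and only depends on sizes that are concentrated. *)

(** * Product measures and resampling *)

Section ProductExpectation.
Variables (R : realType) (I A : finType) (mu : A -> R).
Implicit Types (F G : {ffun I -> A} -> R) (S : {ffun I -> A}) (T : {set I}).

Definition pE F : R := \sum_(S : {ffun I -> A}) (\prod_i mu (S i)) * F S.

Lemma eq_pE F G : (forall S, F S = G S) -> pE F = pE G.
Proof. by move=> FG; apply: eq_bigr => S _; rewrite FG. Qed.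

Lemma pED F G : pE (fun S => F S + G S) = pE F + pE G.
Proof. by rewrite -big_split; apply: eq_bigr => S _; rewrite mulrDr. Qed.

Lemma pEZ c F : pE (fun S => c * F S) = c * pE F.
Proof. by rewrite /pE mulr_sumr; apply: eq_bigr => S _; rewrite mulrCA. Qed.

Lemma pE_sum (J : finType) (Q : pred J) (F : J -> {ffun I -> A} -> R) :
  pE (fun S => \sum_(j | Q j) F j S) = \sum_(j | Q j) pE (F j).
Proof.
by rewrite exchange_big; apply: eq_bigr => S _; rewrite mulr_sumr.
Qed.

(** Distributivity exchanges the sum over configurations with the product over nodes; each node
    outside [T] contributes the total mass 1. *)
Lemma pE_prod T (h : I -> A -> R) : \sum_a mu a = 1 ->
  pE (fun S => \prod_(i in T) h i (S i)) = \prod_(i in T) \sum_a mu a * h i a.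
Proof.
move=> mu1; pose h' i a := if i \in T then mu a * h i a else mu a.
transitivity (\prod_i \sum_a h' i a).
  rewrite bigA_distr_bigA; apply: eq_bigr => S _.
  rewrite [\prod_(i in T) _]big_mkcond -big_split; apply: eq_bigr => i _.
  by rewrite /h' /=; case: ifP => _; rewrite ?mulr1.
rewrite [RHS]big_mkcond; apply: eq_bigr => i _.
by rewrite /h'; case: ifP => // _; rewrite mu1.
Qed.

Lemma pE_cst c : \sum_a mu a = 1 -> pE (fun=> c) = c.
Proof.
move=> mu1; have := pE_prod finset.set0 (fun _ _ => 1) mu1.
rewrite !big_set0 => e; rewrite -[RHS]mulr1 -[in RHS]e -pEZ; apply: eq_pE => S.
by rewrite mulr1.
Qed.

Lemma pE_marginal i (h : A -> R) : \sum_a mu a = 1 ->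
  pE (fun S => h (S i)) = \sum_a mu a * h a.
Proof.
move=> mu1; have := pE_prod [set i] (fun=> h) mu1.
by rewrite big_set1 => <-; apply: eq_pE => S; rewrite big_set1.
Qed.

Definition merge T S' S := [ffun i => if i \in T then S' i else S i].

(* [(S, S') |-> (merge T S' S, merge T S S')] is an involution preserving the
   product weight. *)
Lemma pE_merge T F : \sum_a mu a = 1 ->
  pE F = pE (fun S => pE (fun S' => F (merge T S' S))).
Proof.
move=> mu1.
pose w (S : {ffun I -> A}) := \prod_i mu (S i).
pose sw (p : {ffun I -> A} * {ffun I -> A}) := (merge T p.2 p.1, merge T p.1 p.2).
have swK : involutive sw.
  move=> [S S']; rewrite /sw /=.
  by congr pair; apply/ffunP => i; rewrite !ffunE; case: (i \in T).
have ww p : w (sw p).1 * w (sw p).2 = w p.1 * w p.2.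
  rewrite /w -!big_split; apply: eq_bigr => i _; rewrite !ffunE /=.
  by case: (i \in T); rewrite // mulrC.
transitivity (\sum_p w p.1 * w p.2 * F p.1).
  rewrite -(pair_bigA _ (fun S S' => w S * w S' * F S)) /=.
  apply: eq_bigr => S _; rewrite -mulr_suml -mulr_sumr.
  have -> : \sum_(S' : {ffun I -> A}) w S' = 1.
    by rewrite -[RHS](pE_cst 1 mu1); apply: eq_bigr => ? _; rewrite mulr1.
  by rewrite mulr1.
rewrite (reindex_inj (inv_inj swK)) -(pair_bigA _ (fun S S' =>
  w (sw (S, S')).1 * w (sw (S, S')).2 * F (sw (S, S')).1)) /=.
apply: eq_bigr => S _; rewrite mulr_sumr; apply: eq_bigr => S' _.
by rewrite (ww (S, S')) mulrA.
Qed.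

(** Conditioning on the coordinates outside [T]: as [h a] ignores those inside, a fresh copy of them
    may be drawn, and its independent factors integrate separately. *)
Lemma pE_resample T (h : A -> {ffun I -> A} -> R) : \sum_a mu a = 1 ->
    (forall a S S', h a (merge T S' S) = h a S) ->
  pE (fun S => \prod_(v in T) h (S v) S) =
  pE (fun S => \prod_(v in T) \sum_a mu a * h a S).
Proof.
move=> mu1 hT; rewrite (pE_merge T) //; apply: eq_pE => S.
rewrite -(pE_prod T (fun _ a => h a S) mu1); apply: eq_pE => S'.
by apply: eq_bigr => v vT; rewrite hT !ffunE vT.
Qed.

Hypothesis mu_ge0 : forall a, 0 <= mu a.

Lemma le_pE F G : (forall S, F S <= G S) -> pE F <= pE G.
Proof.
by move=> FG; apply: ler_sum => S _; apply: ler_wpM2l => //; exact: prodr_ge0.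
Qed.

(** The hypothesis on [c] is a bound on a conditional probability, uniform over the outside. It
    serves the union bound with general [T] and the second moment with one or two nodes. *)
Lemma pE_resample_le T h c : \sum_a mu a = 1 ->
    (forall a S S', h a (merge T S' S) = h a S) ->
    (forall a S, 0 <= h a S) -> (forall S, \sum_a mu a * h a S <= c) ->
  pE (fun S => \prod_(v in T) h (S v) S) <= c ^+ #|T|.
Proof.
move=> mu1 hT h0 hc; rewrite pE_resample // -[leRHS](pE_cst _ mu1).
apply: le_pE => S; rewrite -prodr_const.
apply: ler_prod => v _; rewrite hc sumr_ge0 // => a _; exact: mulr_ge0.
Qed.

Lemma pE_indic_le1 (E : pred {ffun I -> A}) : \sum_a mu a = 1 ->
  pE (fun S => (E S)%:R) <= 1.
Proof.
move=> mu1; rewrite -[leRHS](pE_cst _ mu1); apply: le_pE => S.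
by rewrite lern1 leq_b1.
Qed.

(* Chebyshev around an arbitrary centre [M]. *)
Lemma second_moment (B : I -> pred {ffun I -> A}) (M p lo : R) :
    \sum_a mu a = 1 -> 0 < M ->
    (forall v, pE (fun S => (B v S)%:R) <= p) ->
    (forall v, lo <= pE (fun S => (B v S)%:R)) ->
    (forall u v, u != v -> pE (fun S => (B u S && B v S)%:R) <= p ^+ 2) ->
  pE (fun S => [forall v, ~~ B v S]%:R) <=
    (#|I|%:R * p + (#|I|%:R * p) ^+ 2 - 2 * M * (#|I|%:R * lo) + M ^+ 2) / M ^+ 2.
Proof.
move=> mu1 M0 hp hlo hpp.
pose Y (S : {ffun I -> A}) : R := \sum_v (B v S)%:R.
have M20 : 0 < M ^+ 2 by rewrite exprn_gt0.
rewrite ler_pdivlMr // mulrC -pEZ.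
(* When no [B v] holds, [Y S = 0] and [(Y S - M) ^+ 2] equals [M ^+ 2]; elsewhere nonnegativity of
   the square is enough. *)
apply: (@le_trans _ _ (pE (fun S => (Y S ^+ 2 + (- (2 * M)) * Y S) + M ^+ 2))).
  apply: le_pE => S; have -> : Y S ^+ 2 + - (2 * M) * Y S + M ^+ 2 = (Y S - M) ^+ 2 by ring.
  case: forallP => [allB|_]; last by rewrite mulr0 sqr_ge0.
  rewrite /Y big1 ?sub0r ?sqrrN ?mulr1// => v _.
  by rewrite (negbTE (allB v)).
rewrite pED pED pEZ pE_cst // mulNr.
have EY : #|I|%:R * lo <= pE Y.
  rewrite pE_sum mulr_natl -sumr_const; exact: ler_sum.
have EY2 : pE (fun S => Y S ^+ 2) <= #|I|%:R * p + (#|I|%:R * p) ^+ 2.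
  have -> : pE (fun S => Y S ^+ 2) = \sum_u \sum_v pE (fun S => (B u S && B v S)%:R).
    under [RHS]eq_bigr do rewrite -pE_sum.
    rewrite -pE_sum; apply: eq_pE => S; rewrite expr2 /Y mulr_suml.
    apply: eq_bigr => u _; rewrite mulr_sumr; apply: eq_bigr => v _.
    by rewrite -natrM mulnb.
  have -> : #|I|%:R * p + (#|I|%:R * p) ^+ 2 = \sum_(u : I) (p + \sum_(v : I) p ^+ 2).
    rewrite !sumr_const -[p ^+ 2 *+ _]mulr_natl -[(_ + _) *+ _]mulr_natl; ring.
  apply: ler_sum => u _; rewrite (bigD1 u) //=; apply: lerD.
    by under eq_pE do rewrite andbb; exact: hp.
  rewrite [leRHS](bigD1 u) //= -[leLHS]add0r lerD ?sqr_ge0 //.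
  by apply: ler_sum => v vu; rewrite hpp // eq_sym.
rewrite lerD2r lerD // lerN2 ler_wpM2l //; lra.
Qed.

End ProductExpectation.

(** * The law of one object set *)

Section ObjectSetLaw.
Variables (R : realType) (P : nat) (D : size_distr R P).
Implicit Types (A B V Z : {set 'I_P}).

Lemma objset_prob_ge0 A : 0 <= objset_prob D A.
Proof. by rewrite /objset_prob divr_ge0 ?ler0n ?Defs.pmf_ge0. Qed.

Lemma sum_objset_card (h : {set 'I_P} -> R) :
  \sum_A objset_prob D A * h A =
  \sum_(1 <= s < P.+1) D s / 'C(P, s)%:R * \sum_(A : {set 'I_P} | #|A| == s) h A.
Proof.
have cardP A : (#|A| < P.+1)%N.
  by rewrite ltnS -[X in (_ <= X)%N](card_ord P) max_card.
pose F s := D s / 'C(P, s)%:R * \sum_(A : {set 'I_P} | #|A| == s) h A.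
transitivity (\sum_(s < P.+1) F s).
  rewrite (partition_big (fun A => Ordinal (cardP A)) xpredT) //=.
  apply: eq_bigr => s _; rewrite /F mulr_sumr.
  by apply: eq_bigr => A /eqP <-.
rewrite -(big_mkord xpredT F) big_nat_recl // {1}/F pmf_supp // !mul0r add0r.
by rewrite big_add1.
Qed.

Lemma bin_neq0 s : (s < P.+1)%N -> 'C(P, s)%:R != 0 :> R.
Proof. by rewrite pnatr_eq0 -lt0n bin_gt0. Qed.

Lemma card_draws_ord s : #|[pred A : {set 'I_P} | #|A| == s]| = 'C(P, s).
Proof. by rewrite -[P in RHS]card_ord -card_draws; apply: eq_card => A; rewrite !inE. Qed.

Lemma sum_objset_size (g : nat -> R) :
  \sum_A objset_prob D A * g #|A| = \sum_(1 <= s < P.+1) D s * g s.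
Proof.
rewrite sum_objset_card; apply: eq_big_nat => s /andP[_ sP].
rewrite (eq_bigr (fun=> g s)) => [|A /eqP -> //].
rewrite sumr_const card_draws_ord -[g s *+ _]mulr_natl mulrA mulfVK //.
exact: bin_neq0.
Qed.

(** Conditioning on the size: the size probabilities sum to 1, so a bound valid for every size
    survives averaging. *)
Lemma sum_objset_le (h : {set 'I_P} -> R) c :
    (forall s, (s <= P)%N ->
      \sum_(A : {set 'I_P} | #|A| == s) h A <= c * 'C(P, s)%:R) ->
  \sum_A objset_prob D A * h A <= c.
Proof.
move=> hc; rewrite sum_objset_card -[leRHS]mulr1 -[X in _ <= _ * X](pmf_sum1 D) mulr_sumr.
rewrite !big_nat; apply: ler_sum => s /andP[_ sP].
rewrite -mulrA [leRHS]mulrC; apply: ler_wpM2l; first exact: Defs.pmf_ge0.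
by rewrite [leLHS]mulrC ler_pdivrMr ?ltr0n ?bin_gt0 //; exact: hc.
Qed.

(** Sizes rejected by [g] are dropped, which the nonnegativity of [h] allows. *)
Lemma sum_objset_ge (h : {set 'I_P} -> R) (g : pred nat) c :
    (forall A, 0 <= h A) ->
    (forall s, (s <= P)%N -> g s ->
      c * 'C(P, s)%:R <= \sum_(A : {set 'I_P} | #|A| == s) h A) ->
  c * \sum_A objset_prob D A * (g #|A|)%:R <= \sum_A objset_prob D A * h A.
Proof.
move=> h0 hc; rewrite (sum_objset_size (fun s => (g s)%:R)) sum_objset_card.
rewrite mulr_sumr !big_nat; apply: ler_sum => s /andP[_ sP].
case: (boolP (g s)) => gs; last first.
  by rewrite !mulr0 mulr_ge0 ?divr_ge0 ?Defs.pmf_ge0 ?ler0n ?sumr_ge0.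
rewrite mulr1 mulrC -[leRHS]mulrA; apply: ler_wpM2l; first exact: Defs.pmf_ge0.
by rewrite [leRHS]mulrC ler_pdivlMr ?ltr0n ?bin_gt0 //; exact: hc.
Qed.

Lemma card_draws_avoid B s :
  #|[set A : {set 'I_P} | (#|A| == s) && [disjoint A & B]]| = 'C(P - #|B|, s).
Proof.
have <- : #|~: B| = (P - #|B|)%N by rewrite cardsCs finset.setCK card_ord.
rewrite -cards_draws; apply: eq_card => A; rewrite !inE andbC.
by rewrite finset.subsets_disjoint finset.setCK.
Qed.

Lemma sum_objset_mem (a : 'I_P) :
  \sum_A objset_prob D A * (a \in A)%:R = size_mean D / P%:R.
Proof.
rewrite sum_objset_card /size_mean mulr_suml; apply: eq_big_nat => s /andP[s0 sP].
have P0 : P%:R != 0 :> R by rewrite pnatr_eq0; case: P a => [[]|].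
have bn := bin_neq0 sP.
have -> : \sum_(A : {set 'I_P} | #|A| == s) (a \in A)%:R =
    'C(P.-1, s.-1)%:R :> R.
  (* Only sets avoiding [a] are counted directly; Pascal's rule then yields those containing [a]. *)
  apply/eqP; rewrite -(inj_eq (addrI 'C(P.-1, s)%:R)) -natrD.
  have -> : ('C(P.-1, s) + 'C(P.-1, s.-1) = 'C(P, s))%N.
    by case: s s0 {sP bn} => // s _; case: P a {P0} => [[]|P' _] //=; rewrite -binS.
  have -> : 'C(P.-1, s)%:R = \sum_(A : {set 'I_P} | #|A| == s) (a \notin A)%:R :> R.
    rewrite -subn1 -(cards1 a) -card_draws_avoid -sum1_card natr_sum.
    rewrite [LHS]big_mkcond [RHS]big_mkcond; apply: eq_bigr => A _.
    rewrite inE disjoint_sym disjoints1; case: (_ == s) => //=.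
    by case: (a \in A).
  rewrite -big_split /= (eq_bigr (fun=> 1)) => [|A _]; last first.
    by case: (a \in A) => /=; rewrite ?addr0 ?add0r.
  by rewrite sumr_const card_draws_ord.
have -> : 'C(P.-1, s.-1)%:R = s%:R * 'C(P, s)%:R / P%:R :> R.
  apply: (mulIf P0); rewrite mulfVK // -!natrM; congr (_%:R).
  case: s s0 {sP bn} => // s _; case: P a {P0} => [[]|P' _] //=.
  by rewrite mulnC mul_bin_diag.
by field; rewrite bn P0.
Qed.

(** Union is a bijection onto these sets from the pairs made of a [j]-subset of [V] and an
    [(s - j)]-subset of [Z]. *)
Lemma card_draws_split V Z j s : (j <= s)%N -> [disjoint V & Z] ->
  #|[set A : {set 'I_P} | [&& A \subset V :|: Z, #|A :&: V| == j & #|A| == s]]| =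
  ('C(#|V|, j) * 'C(#|Z|, s - j))%N.
Proof.
move=> js VZ; rewrite -!cards_draws -cardsX.
pose f (p : {set 'I_P} * {set 'I_P}) := p.1 :|: p.2.
pose X := finset.setX [set B : {set 'I_P} | B \subset V & #|B| == j]
               [set B : {set 'I_P} | B \subset Z & #|B| == (s - j)%N].
have VZ0 : V :&: Z = finset.set0 by apply/eqP; rewrite finset.setI_eq0.
have pV p : p \in X -> f p :&: V = p.1 /\ f p :&: Z = p.2.
  rewrite !inE => /andP[/andP[pV _] /andP[pZ _]]; rewrite /f !finset.setIUl.
  rewrite (finset.setIidPl pV) (finset.setIidPl pZ); split.
    rewrite (_ : p.2 :&: V = finset.set0) ?finset.setU0 //.
    by apply/eqP; rewrite -finset.subset0 -VZ0 finset.setIC finset.setIS.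
  rewrite (_ : p.1 :&: Z = finset.set0) ?finset.set0U //.
  by apply/eqP; rewrite -finset.subset0 -VZ0 finset.setSI.
rewrite -(card_in_imset (f := f) (D := mem X)); last first.
  move=> p p' /pV[p1 p2] /pV[p1' p2'] ff.
  by rewrite [p]surjective_pairing [p']surjective_pairing -p1 -p2 -p1' -p2' ff.
apply: eq_card => A; rewrite inE; apply/idP/imsetP.
  move=> /and3P[AVZ /eqP AV /eqP As].
  have AE : A :&: V :|: A :&: Z = A.
    by rewrite -finset.setIUr; exact/finset.setIidPl.
  exists (A :&: V, A :&: Z); last by rewrite /f /= AE.
  rewrite !inE /= !finset.subsetIr AV eqxx /=; apply/eqP.
  rewrite -As -AV -{2}AE cardsU finset.setIACA finset.setIid VZ0 finset.setI0 cards0 subn0.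
  by rewrite addnC addnK.
move=> [p pX ->]; have [p1 p2] := pV _ pX.
move: (pX); rewrite !inE => /andP[/andP[sV /eqP cV] /andP[sZ /eqP cZ]].
rewrite p1 cV eqxx finset.setUSS //=; apply/eqP.
rewrite cardsU cV cZ (_ : p.1 :&: p.2 = finset.set0) ?cards0 ?subn0 ?subnKC //.
by apply/eqP; rewrite -finset.subset0 -VZ0 finset.setISS.
Qed.

End ObjectSetLaw.

(** * Hypergeometric probabilities *)

Section FallingFactorials.
Variable R : realType.

Lemma ffact_real_prod a t : (a ^_ t)%:R = \prod_(i < t) (a - i)%N%:R :> R.
Proof. by rewrite ffact_prod natr_prod. Qed.

(** Factor by factor, [a - d - i <= (a - i) (1 - d / N)] because [a - i <= N], and
    [1 - y <= exp (- y)]. *)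
Lemma ffact_ratio_le (a d N t : nat) : (a <= N)%N ->
  ((a - d) ^_ t)%:R <= (a ^_ t)%:R * expR (- (d%:R / N%:R)) ^+ t :> R.
Proof.
move=> aN; rewrite !ffact_real_prod -[t in _ ^+ t]card_ord -prodr_const -big_split.
apply: ler_prod => i _; rewrite ler0n /=.
(* Truncated subtraction makes the left factor zero in this case. *)
have [ai|ai] := leqP (a - d) i.
  by rewrite (_ : (a - d - i)%N = 0%N) ?mulr_ge0 ?expR_ge0 //; lia.
have N0 : 0 < N%:R :> R by rewrite ltr0n; lia.
apply: (@le_trans _ _ ((a - i)%N%:R * (1 + - (d%:R / N%:R)))).
  have -> : (a - d - i)%N%:R = (a - i)%N%:R - d%:R :> R.
    by rewrite -natrB; [congr (_%:R); lia | lia].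
  rewrite mulrDr mulr1 mulrN lerD2l lerN2 mulrCA ler_piMr // ler_pdivrMr // mul1r ler_nat; lia.
by apply: ler_wpM2l => //; exact: expR_ge1Dx.
Qed.

(** Here [a - i = (a - d - i) + d], and every [a - d - i] is at least [a - d - t]. *)
Lemma ffact_ratio_ge (a d t : nat) : (d + t < a)%N ->
  (a ^_ t)%:R <= ((a - d) ^_ t)%:R * expR (d%:R / (a - d - t)%N%:R) ^+ t :> R.
Proof.
move=> dta; rewrite !ffact_real_prod -[t in _ ^+ t]card_ord -prodr_const -big_split.
apply: ler_prod => i _; rewrite ler0n /=; have := ltn_ord i => it.
have N0 : 0 < (a - d - t)%N%:R :> R by rewrite ltr0n; lia.
apply: (@le_trans _ _ ((a - d - i)%N%:R * (1 + d%:R / (a - d - t)%N%:R))).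
  have -> : (a - i)%N%:R = (a - d - i)%N%:R + d%:R :> R.
    by rewrite -natrD; congr (_%:R); lia.
  rewrite mulrDr mulr1 lerD2l mulrCA ler_peMr // ler_pdivlMr // mul1r ler_nat; lia.
by apply: ler_wpM2l => //; exact: expR_ge1Dx.
Qed.

Lemma ffact_le_exp a t : (a ^_ t)%:R <= a%:R ^+ t :> R.
Proof.
rewrite ffact_real_prod -[t in _ ^+ t]card_ord -prodr_const.
by apply: ler_prod => i _; rewrite ler0n ler_nat leq_subr.
Qed.

Lemma ffact_ge_exp a t : (a - t)%N%:R ^+ t <= (a ^_ t)%:R :> R.
Proof.
rewrite ffact_real_prod -[t in _ ^+ t]card_ord -prodr_const.
by apply: ler_prod => i _; rewrite ler0n ler_nat leq_sub2l // ltnW.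
Qed.

Lemma ffact_div_le_exp s P t : (s <= P)%N ->
  (s ^_ t)%:R * P%:R ^+ t <= s%:R ^+ t * (P ^_ t)%:R :> R.
Proof.
move=> sP; have expE (x : R) : x ^+ t = \prod_(i < t) x by rewrite prodr_const card_ord.
rewrite !ffact_real_prod !expE -!big_split /=; apply: ler_prod => i _.
rewrite mulr_ge0 //= -!natrM ler_nat; nia.
Qed.

(** A division-free form of ['C(P - v, s - j) / 'C(P, s) = s ^_ j (P - v) ^_ (s - j) / P ^_ s], with
    [P ^_ s] split after its first [j] factors. *)
Lemma bin_draw_ffact (P v s j : nat) : (j <= s <= P)%N ->
  ('C(P - v, s - j) * (P ^_ j * (P - j) ^_ (s - j)) =
   s ^_ j * (P - v) ^_ (s - j) * 'C(P, s))%N.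
Proof.
move=> /andP[js sP].
have e1 : (P ^_ j * (P - j) ^_ (s - j) = 'C(P, s) * s`!)%N.
  rewrite bin_ffact; apply/eqP; rewrite -(eqn_pmul2r (fact_gt0 (P - s))).
  rewrite -mulnA (_ : P - s = P - j - (s - j))%N; last lia.
  rewrite !ffact_fact ?leq_sub2r //; last lia.
  by rewrite (_ : P - j - (s - j) = P - s)%N ?ffact_fact //; lia.
have e2 : (s ^_ j * (s - j)`! = s`!)%N by rewrite ffact_fact.
rewrite e1 -e2 -(bin_ffact (P - v) (s - j)); lia.
Qed.

(** The hypergeometric weight splits into ['C(v, j) s ^_ j / P ^_ j], giving the power over [j!],
    and a ratio of falling factorials, giving the exponential since [P - v = (P - j) - (v - j)]. *)
Lemma hypergeometric_le (P v s j : nat) : (j <= s <= P)%N -> (v <= P)%N ->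
  'C(v, j)%:R * 'C(P - v, s - j)%:R <=
  'C(P, s)%:R * ((v%:R * s%:R / P%:R) ^+ j / j`!%:R *
    expR (- ((v - j)%N%:R * (s - j)%N%:R / P%:R))) :> R.
Proof.
move=> jsP vP; have /andP[js sP] := jsP.
have [vj|jv] := ltnP v j.
  by rewrite bin_small // mul0r mulr_ge0 // mulr_ge0 ?expR_ge0 // divr_ge0.
case: (posnP P) => [P0|P0].
  have [j0 s0 v0] : [/\ j = 0%N, s = 0%N & v = 0%N] by split; lia.
  by rewrite P0 j0 s0 v0 !mul0r oppr0 expR0 expr0 fact0 invr1 !mulr1.
have PR : 0 < P%:R :> R by rewrite ltr0n.
have fj : 0 < j`!%:R :> R by rewrite ltr0n fact_gt0.
have Pj : 0 < (P ^_ j)%:R :> R by rewrite ltr0n ffact_gt0; lia.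
have Pjs : 0 < ((P - j) ^_ (s - j))%:R :> R by rewrite ltr0n ffact_gt0; lia.
have e := congr1 (fun x => x%:R : R) (bin_draw_ffact v jsP).
rewrite !natrM in e.
have -> : 'C(P - v, s - j)%:R = (s ^_ j)%:R / (P ^_ j)%:R *
    (((P - v) ^_ (s - j))%:R / ((P - j) ^_ (s - j))%:R) * 'C(P, s)%:R :> R.
  apply: (mulIf (lt0r_neq0 (mulr_gt0 Pj Pjs))); rewrite e.
  by field; rewrite !gt_eqF.
rewrite [leLHS]mulrA [leRHS]mulrC; apply: ler_wpM2r => //.
rewrite [leLHS]mulrA; apply: ler_pM.
- by rewrite mulr_ge0 ?divr_ge0.
- by rewrite divr_ge0.
- rewrite -[_ / j`!%:R]mulrC ler_pdivlMl // mulrA.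
  have -> : j`!%:R * 'C(v, j)%:R = (v ^_ j)%:R :> R by rewrite mulrC -natrM bin_ffact.
  rewrite -[v%:R * _ / _]mulrA exprMn; apply: ler_pM; rewrite ?divr_ge0 ?ffact_le_exp //.
  rewrite ler_pdivrMr // expr_div_n mulrAC ler_pdivlMr ?exprn_gt0 //.
  exact: ffact_div_le_exp.
- rewrite ler_pdivrMr // mulrC.
  have -> : (P - v = (P - j) - (v - j))%N by lia.
  apply: (le_trans (ffact_ratio_le (N := P) _ _ _)); first exact: leq_subr.
  by rewrite ler_pM2l // -expRM_natr mulNr mulrAC.
Qed.

(** Two sizes occur because the [j] chosen objects must come from the disjoint pieces, of total size
    [v], while the others must avoid the whole union, of size [u]. *)
Lemma hypergeometric_ge (P u v s j : nat) : (j <= s)%N -> (v <= u)%N -> (u + s < P)%N ->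
  'C(P, s)%:R * (((v - j)%N%:R * (s - j)%N%:R / P%:R) ^+ j / j`!%:R *
    expR (- (s%:R * u%:R / (P - u - s)%N%:R))) <=
  'C(v, j)%:R * 'C(P - u, s - j)%:R :> R.
Proof.
move=> js vu usP; have [uj|ju] := ltnP u j.
  have -> : (v - j = 0)%N by lia.
  by rewrite !mul0r expr0n (_ : (j == 0%N) = false) ?mul0r ?mulr0 ?mulr_ge0 //; lia.
have jsP : (j <= s <= P)%N by lia.
have PR : 0 < P%:R :> R by rewrite ltr0n; lia.
have QR : 0 < (P - u - s)%N%:R :> R by rewrite ltr0n; lia.
have fj : 0 < j`!%:R :> R by rewrite ltr0n fact_gt0.
have Pj : 0 < (P ^_ j)%:R :> R by rewrite ltr0n ffact_gt0; lia.
have Pjs : 0 < ((P - j) ^_ (s - j))%:R :> R by rewrite ltr0n ffact_gt0; lia.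
have e := congr1 (fun x => x%:R : R) (bin_draw_ffact u jsP).
rewrite !natrM in e.
have -> : 'C(P - u, s - j)%:R = (s ^_ j)%:R / (P ^_ j)%:R *
    (((P - u) ^_ (s - j))%:R / ((P - j) ^_ (s - j))%:R) * 'C(P, s)%:R :> R.
  apply: (mulIf (lt0r_neq0 (mulr_gt0 Pj Pjs))); rewrite e.
  by field; rewrite !gt_eqF.
rewrite [leRHS]mulrA [leRHS]mulrC; apply: ler_wpM2l => //.
rewrite [leRHS]mulrA; apply: ler_pM.
- by rewrite divr_ge0 // exprn_ge0 // divr_ge0 // mulr_ge0.
- exact: expR_ge0.
- rewrite -[_ / j`!%:R]mulrC ler_pdivrMl // mulrA.
  have -> : j`!%:R * 'C(v, j)%:R = (v ^_ j)%:R :> R by rewrite mulrC -natrM bin_ffact.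
  rewrite -[(v - j)%N%:R * _ / _]mulrA exprMn.
  apply: ler_pM; rewrite ?exprn_ge0 ?divr_ge0 ?ffact_ge_exp //.
  rewrite expr_div_n; apply: ler_pM; rewrite ?invr_ge0 ?exprn_ge0 ?ffact_ge_exp //.
  by rewrite lef_pV2 ?posrE ?exprn_gt0 // ffact_le_exp.
- rewrite ler_pdivlMr // mulrC expRN ler_pdivrMr ?expR_gt0 //.
  have duj : (u - j + (s - j) < P - j)%N by lia.
  apply: (le_trans (ffact_ratio_ge duj)).
  have -> : (P - j - (u - j) = P - u)%N by lia.
  apply: ler_wpM2l => //; rewrite -expRM_natr ler_expR mulrC mulrA.
  apply: ler_pM; rewrite ?mulr_ge0 ?invr_ge0 //.
    by rewrite -!natrM ler_nat leq_mul // leq_subr.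
  by rewrite lef_pV2 ?posrE ?ltr0n ?ler_nat; lia.
Qed.

End FallingFactorials.

(** * Pieces and overlaps *)

Section Pieces.
Variables (I : finType) (P : nat).
Implicit Types (W T : {set I}) (S : {ffun I -> {set 'I_P}}) (A B : {set 'I_P}).

(** Disjoint substitutes for the sets [S w]; the loss in size is controlled by [overlap]. *)
Definition piece W S w : {set 'I_P} := S w :\: \bigcup_(i in W | i != w) S i.

(** Ordered pairs are summed, so each intersection counts twice: both of its sets lose it when
    passing to pieces. *)
Definition overlap W S : nat :=
  (\sum_(i in W) \sum_(j in W | j != i) #|S i :&: S j|)%N.

(** For [A = S v] with [v] outside [W] this is the number of neighbours of [v] in [W]; [A] is kept
    as a separate argument so that it can be redrawn with [S] fixed on [W]. *)
Definition hits W S A : nat := #|[set w in W | ~~ [disjoint A & S w]]|.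

Lemma piece_sub W S w : piece W S w \subset S w.
Proof. exact: finset.subsetDl. Qed.

Lemma piece_disjoint W S i j : i \in W -> i != j ->
  [disjoint piece W S i & piece W S j].
Proof.
move=> iW ij; rewrite -finset.setI_eq0 -finset.subset0; apply/fintype.subsetP => a.
rewrite !inE => /andP[/andP[_ ai] /andP[/bigcupP []]].
by exists i; rewrite ?iW.
Qed.

Lemma leq_card_bigcup (J : finType) (Q : pred J) (F : J -> {set 'I_P}) :
  (#|\bigcup_(j | Q j) F j| <= \sum_(j | Q j) #|F j|)%N.
Proof.
elim/big_rec2: _ => [|j n B _ IH]; first by rewrite cards0.
by rewrite cardsU; lia.
Qed.

Lemma card_le_piece W S w :
  (#|S w| <= #|piece W S w| + \sum_(j in W | j != w) #|S w :&: S j|)%N.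
Proof.
rewrite -(cardsID (\bigcup_(j in W | j != w) S j) (S w)) addnC leq_add2l.
by rewrite big_distrr /=; exact: leq_card_bigcup.
Qed.

Lemma sum_card_le_piece W S :
  (\sum_(w in W) #|S w| <= \sum_(w in W) #|piece W S w| + overlap W S)%N.
Proof. by rewrite -big_split; apply: leq_sum => w _; exact: card_le_piece. Qed.

Lemma card_bigcup_disjoint W (F : I -> {set 'I_P}) :
    {in W &, forall i j, i != j -> [disjoint F i & F j]} ->
  #|\bigcup_(w in W) F w| = (\sum_(w in W) #|F w|)%N.
Proof.
move=> dF; pose G w := if w \in W then F w else finset.set0.
have Gdisj i j : i != j -> [disjoint G i & G j].
  rewrite /G; case: ifP => iW; last by rewrite -finset.setI_eq0 finset.set0I.
  case: ifP => jW ij; last by rewrite -finset.setI_eq0 finset.setI0.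
  exact: dF.
have -> : \bigcup_(w in W) F w = \bigcup_w G w.
  by rewrite big_mkcond; apply: eq_bigr => w _; rewrite /G.
rewrite -sum1_card partition_disjoint_bigcup // [RHS]big_mkcond.
by apply: eq_bigr => w _; rewrite /G sum1_card; case: ifP; rewrite ?cards0.
Qed.

Lemma overlap_mono W W' S : W \subset W' -> (overlap W S <= overlap W' S)%N.
Proof.
move=> /fintype.subsetP WW'; rewrite /overlap [leqRHS](bigID (mem W)) /=.
apply: leq_trans (leq_addr _ _).
rewrite [leqRHS](eq_bigl (mem W)); last first.
  by move=> i /=; case: (boolP (i \in W)) => [/WW' ->|]; rewrite ?andbF.
apply: leq_sum => i _; rewrite [leqRHS](bigID (mem W)) /=.
apply: leq_trans (leq_addr _ _); apply: eq_leq; apply: eq_bigl => j.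
by case: (boolP (j \in W)) => [/WW' ->|]; rewrite ?andbF ?andbT.
Qed.

Lemma overlap_merge W T S S' : [disjoint W & T] ->
  overlap W (merge T S' S) = overlap W S.
Proof.
move=> WT; have e w : w \in W -> merge T S' S w = S w.
  by move=> wW; rewrite ffunE (disjointFr WT).
apply: eq_bigr => i iW; apply: eq_bigr => j /andP[jW _].
by rewrite !e.
Qed.

Lemma hits_merge W T S S' A : [disjoint W & T] ->
  hits W (merge T S' S) A = hits W S A.
Proof.
move=> WT; apply: eq_card => w; rewrite !inE ffunE.
by case: (boolP (w \in W)) => // wW; rewrite (disjointFr WT).
Qed.

(** Avoiding [S w] implies avoiding its piece, so passing to pieces can only turn a factor [x] into
    a factor 1. *)
Lemma exp_hits_le (R : realType) W S A (x : R) : 0 <= x <= 1 ->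
  x ^+ hits W S A <=
  \prod_(w in W) (x + (1 - x) * [disjoint A & piece W S w]%:R).
Proof.
move=> /andP[x0 x1].
have -> : x ^+ hits W S A = \prod_(w in W) (if [disjoint A & S w] then 1 else x).
  rewrite /hits -prodr_const big_mkcond [RHS]big_mkcond; apply: eq_bigr => w _.
  by rewrite inE; case: (w \in W) => //=; case: [disjoint _ & _].
apply: ler_prod => w _; case: (boolP [disjoint A & S w]) => AS.
  by rewrite ler01 /= (fintype.disjointWr (piece_sub W S w) AS) mulr1 addrC subrK.
by rewrite x0 lerDl mulr_ge0 // subr_ge0.
Qed.

(* Expanding a factor [x + (1-x) 1[A misses B w]] either keeps [B w] out of the
   forbidden set or merges it into [B0]. *)
Lemma sum_prod_avoid_le (R : realType) (B : I -> {set 'I_P}) (s : nat) (x : R)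
    (l : seq I) (B0 : {set 'I_P}) : (s <= P)%N -> 0 <= x <= 1 -> uniq l ->
    {in l &, forall i j, i != j -> [disjoint B i & B j]} ->
    {in l, forall i, [disjoint B0 & B i]} ->
  \sum_(A : {set 'I_P} | #|A| == s) [disjoint A & B0]%:R *
      \prod_(w <- l) (x + (1 - x) * [disjoint A & B w]%:R) <=
  'C(P, s)%:R * expR (- (s%:R * #|B0|%:R / P%:R)) *
     \prod_(w <- l) (x + (1 - x) * expR (- (s%:R * #|B w|%:R / P%:R))).
Proof.
move=> sP /andP[x0 x1]; elim: l B0 => [|w l IH] B0 /=.
  move=> _ _ _; under eq_bigr do rewrite big_nil mulr1.
  have -> : \sum_(A : {set 'I_P} | #|A| == s) [disjoint A & B0]%:R =
      'C(P - #|B0|, s)%:R :> R.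
    rewrite -card_draws_avoid -sum1_card natr_sum big_mkcond [RHS]big_mkcond.
    by apply: eq_bigr => A _; rewrite inE; case: (_ == s); case: [disjoint _ & _].
  rewrite big_nil mulr1.
  have BP : (#|B0| <= P)%N by rewrite -[X in (_ <= X)%N]card_ord max_card.
  (* With no factor left, the sum counts sets avoiding [B0], which is the case [j = 0]. *)
  have := @hypergeometric_le R P #|B0| s 0 _ _.
  rewrite bin0 mul1r expr0 fact0 invr1 !mul1r !subn0 [#|B0|%:R * _]mulrC.
  by apply; rewrite ?sP.
move=> /andP[wl ul] disj disj0.
have wwl : w \in w :: l by rewrite inE eqxx.
have disjl : {in l &, forall i j, i != j -> [disjoint B i & B j]}.
  by move=> i j il jl; apply: disj; rewrite inE (il, jl) orbT.
have IH1 := IH B0 ul disjl (fun i il => disj0 i (mem_behead (s := w :: l) il)).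
have IH2 := IH (B0 :|: B w) ul disjl.
have cU : #|B0 :|: B w| = (#|B0| + #|B w|)%N.
  have := disj0 _ wwl; rewrite -finset.setI_eq0 => /eqP e.
  by rewrite cardsU e cards0 subn0.
rewrite cU in IH2; set Q := \prod_(w <- l) _ in IH1 IH2.
have -> : \sum_(A : {set 'I_P} | #|A| == s) [disjoint A & B0]%:R *
    \prod_(v <- w :: l) (x + (1 - x) * [disjoint A & B v]%:R) =
    x * (\sum_(A : {set 'I_P} | #|A| == s) [disjoint A & B0]%:R *
      \prod_(v <- l) (x + (1 - x) * [disjoint A & B v]%:R)) +
    (1 - x) * (\sum_(A : {set 'I_P} | #|A| == s) [disjoint A & B0 :|: B w]%:R *
      \prod_(v <- l) (x + (1 - x) * [disjoint A & B v]%:R)).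
  rewrite !mulr_sumr -big_split; apply: eq_bigr => A _ /=.
  rewrite big_cons; have -> : [disjoint A & B0 :|: B w]%:R =
      [disjoint A & B0]%:R * [disjoint A & B w]%:R :> R.
    rewrite -natrM mulnb; congr (nat_of_bool _)%:R.
    by rewrite -!finset.setI_eq0 finset.setIUr finset.setU_eq0.
  ring.
rewrite big_cons -/Q.
apply: (@le_trans _ _ (x * ('C(P, s)%:R * expR (- (s%:R * #|B0|%:R / P%:R)) * Q) +
  (1 - x) * ('C(P, s)%:R * expR (- (s%:R * (#|B0| + #|B w|)%:R / P%:R)) * Q))).
  apply: lerD; first exact: ler_wpM2l.
  apply: ler_wpM2l; first by rewrite subr_ge0.
  apply: IH2 => i il; rewrite -finset.setI_eq0 finset.setIUl finset.setU_eq0.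
  rewrite !finset.setI_eq0 disj0 ?inE ?il ?orbT //= disj //.
    by rewrite inE il orbT.
  by apply: contraNneq wl => ->.
rewrite natrD mulrDr mulrDl opprD expRD le_eqVlt; apply/orP; left; apply/eqP.
ring.
Qed.

End Pieces.

(** * Good configurations and the lower tail of the number of hits *)

Section GoodConfigurations.
Variables (R : realType) (I : finType) (P : nat) (m eta q : R).
Implicit Types (W T : {set I}) (S : {ffun I -> {set 'I_P}}) (A B : {set 'I_P}).

Definition near_mean (s : nat) : bool := `|s%:R - m| <= eta * m.

Definition good W S : bool :=
  [forall w in W, near_mean #|S w|] && ((overlap W S)%:R <= q).

Lemma near_meanP s : near_mean s -> (1 - eta) * m <= s%:R <= (1 + eta) * m.
Proof. by rewrite /near_mean ler_norml => /andP[]; lra. Qed.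

Lemma goodS W W' S : W \subset W' -> good W' S -> good W S.
Proof.
move=> WW' /andP[/'forall_implyP nW' oW']; apply/andP; split.
  by apply/'forall_implyP => w wW; apply: nW'; exact: (fintype.subsetP WW').
by apply: le_trans oW'; rewrite ler_nat; exact: overlap_mono.
Qed.

Lemma good_merge W T S S' : [disjoint W & T] ->
  good W (merge T S' S) = good W S.
Proof.
move=> WT; rewrite /good overlap_merge //; congr (_ && _).
apply: eq_forallb => w; rewrite ffunE.
by case: (boolP (w \in W)) => // wW; rewrite (disjointFr WT).
Qed.

Lemma good_sum_piece W S : good W S ->
  #|W|%:R * ((1 - eta) * m) - q <= (\sum_(w in W) #|piece W S w|)%N%:R.
Proof.
move=> /andP[/'forall_implyP nW oW].
have : (\sum_(w in W) #|S w|)%N%:R <=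
    (\sum_(w in W) #|piece W S w| + overlap W S)%N%:R :> R.
  by rewrite ler_nat sum_card_le_piece.
have : #|W|%:R * ((1 - eta) * m) <= (\sum_(w in W) #|S w|)%N%:R.
  rewrite natr_sum mulr_natl -sumr_const; apply: ler_sum => w wW.
  by have /andP[] := near_meanP (nW _ wW).
rewrite natrD; lra.
Qed.

(** Goes through [1 / (1 + y)], using [(1 - y + y^2) (1 + y) = 1 + y^3]. *)
Lemma expRN_le_quadratic (y : R) : 0 <= y -> expR (- y) <= 1 - y + y ^+ 2.
Proof.
move=> y0; rewrite expRN.
have y1 : 0 < 1 + y by lra.
apply: (@le_trans _ _ (1 + y)^-1).
  by rewrite lef_pV2 ?posrE ?expR_gt0 //; exact: expR_ge1Dx.
rewrite -div1r ler_pdivrMr //.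
have -> : (1 - y + y ^+ 2) * (1 + y) = 1 + y ^+ 3 by ring.
by rewrite lerDl exprn_ge0.
Qed.

(* Markov's inequality for [x ^+ hits] with [x = 1 / lam], which is optimal up to
   a constant factor for a Poisson-like number of hits. *)
Lemma few_hits_le (n s k : nat) W S (lam : R) : (s <= P)%N -> (0 < P)%N -> (0 < n)%N ->
    0 <= m -> 0 <= eta <= 1 -> 0 <= q -> (#|W| <= n)%N ->
    lam = n%:R * m ^+ 2 / P%:R -> 1 <= lam ->
    near_mean s -> good W S ->
  \sum_(A : {set 'I_P} | #|A| == s) (hits W S A <= k)%N%:R <=
  lam ^+ k * expR (1 + (2 * eta * lam + m * q / P%:R + 16 * lam ^+ 2 / n%:R)
                   - #|W|%:R / n%:R * lam) * 'C(P, s)%:R.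
Proof.
move=> sP P0 n0 m0 /andP[e0 e1] q0 Wn lamE lam1 ns gW.
set delta := 2 * eta * lam + _ + _.
have P0R : 0 < P%:R :> R by rewrite ltr0n.
have n0R : 0 < n%:R :> R by rewrite ltr0n.
have lam0 : 0 < lam by lra.
pose x := lam^-1.
have x0 : 0 < x by rewrite invr_gt0.
have x1 : x <= 1 by rewrite invf_le1.
(* [y w] is the mean number of objects a uniform [s]-set has in the piece of [w]. [Z] bounds from
   below the sum of the [1 - exp (- y w)], and [1 - Z0] is the exponent to be reached. *)
pose y w := s%:R * #|piece W S w|%:R / P%:R : R.
have y0 w : 0 <= y w by rewrite divr_ge0 ?mulr_ge0.
pose Z : R := \sum_(w in W) (y w - y w ^+ 2).
pose Z0 : R := #|W|%:R / n%:R * lam - delta.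
have /andP[slo shi] := near_meanP ns.
have nsmall w : w \in W -> #|S w|%:R <= (1 + eta) * m.
  have /andP[/'forall_implyP nW _] := gW.
  by move=> wW; have /andP[] := near_meanP (nW _ wW).
have ysmall w : w \in W -> y w <= 4 * lam / n%:R.
  move=> wW; have pw : #|piece W S w|%:R <= 2 * m.
    apply: (@le_trans _ _ #|S w|%:R); first by rewrite ler_nat subset_leq_card // piece_sub.
    have := nsmall _ wW; nra.
  have -> : 4 * lam / n%:R = (2 * m) * (2 * m) / P%:R.
    by rewrite lamE; field; rewrite !gt_eqF.
  rewrite ler_pM2r ?invr_gt0 //; apply: ler_pM => //; nra.
have Zge : Z0 <= Z.
  rewrite /Z big_split /= sumrN.
  have : \sum_(w in W) y w ^+ 2 <= 16 * lam ^+ 2 / n%:R.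
    apply: (@le_trans _ _ (\sum_(w in W) (4 * lam / n%:R) ^+ 2)).
      by apply: ler_sum => w wW; rewrite lerXn2r ?nnegrE ?ysmall // divr_ge0 ?mulr_ge0 ?ltW.
    rewrite sumr_const -[_ *+ #|W|]mulr_natl.
    apply: (@le_trans _ _ (n%:R * (4 * lam / n%:R) ^+ 2)).
      by rewrite ler_wpM2r ?sqr_ge0 // ler_nat.
    by rewrite le_eqVlt; apply/orP; left; apply/eqP; field; rewrite gt_eqF.
  have -> : \sum_(w in W) y w = (\sum_(w in W) #|piece W S w|)%N%:R * (s%:R / P%:R).
    by rewrite natr_sum mulr_suml; apply: eq_bigr => w _; rewrite /y; ring.
  have := good_sum_piece gW.
  set V := (\sum_(w in W) _)%N%:R => Vge.
  have V0 : 0 <= V by [].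
  have r1 : V * ((1 - eta) * m / P%:R) <= V * (s%:R / P%:R).
    by rewrite ler_wpM2l // ler_pM2r ?invr_gt0.
  have r2 : (#|W|%:R * ((1 - eta) * m) - q) * ((1 - eta) * m / P%:R) <=
      V * ((1 - eta) * m / P%:R).
    by rewrite ler_wpM2r // divr_ge0 // mulr_ge0 //; lra.
  have -> : Z0 = #|W|%:R * m ^+ 2 / P%:R - delta.
    by rewrite /Z0 lamE; congr (_ - _); field; rewrite !gt_eqF.
  have r3 : (#|W|%:R * ((1 - eta) * m) - q) * ((1 - eta) * m / P%:R) =
     #|W|%:R * m ^+ 2 / P%:R * (1 - eta) ^+ 2 - (1 - eta) * (m * q / P%:R) by ring.
  have b0 : 0 <= m * q / P%:R by rewrite divr_ge0 ?mulr_ge0.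
  have a1 : #|W|%:R * m ^+ 2 / P%:R <= lam.
    rewrite lamE ler_pM2r ?invr_gt0 // ler_wpM2r ?sqr_ge0 // ler_nat //.
  have a0 : 0 <= #|W|%:R * m ^+ 2 / P%:R by rewrite divr_ge0 ?mulr_ge0 ?sqr_ge0.
  move=> hsq; rewrite /delta; move: r1 r2 r3 b0 a1 a0 hsq.
  set a := #|W|%:R * m ^+ 2 / P%:R; set b := m * q / P%:R; set c := 16 * _ / _.
  move=> r1 r2 r3 b0 a1 a0 hsq.
  have : a - 2 * eta * lam - b <= a * (1 - eta) ^+ 2 - (1 - eta) * b by nra.
  lra.
have Z0lam : Z0 <= lam.
  have d0 : 0 <= delta.
    by rewrite /delta !addr_ge0 ?divr_ge0 ?mulr_ge0 ?sqr_ge0 ?(ltW lam0) //.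
  have : #|W|%:R / n%:R * lam <= lam.
    by rewrite ger_pMl // ler_pdivrMr // mul1r ler_nat.
  rewrite /Z0; lra.
(* Since [x Z0 <= x lam = 1], the choice of [x] loses only a factor [e], the leading [1] of the
   exponent. *)
have hxZ : Z0 - 1 <= (1 - x) * Z.
  have : (1 - x) * Z0 <= (1 - x) * Z by rewrite ler_wpM2l // subr_ge0.
  have : x * Z0 <= 1 by rewrite mulrC ler_pdivrMr ?mul1r.
  lra.
have prodle : \prod_(w in W) (x + (1 - x) * expR (- y w)) <= expR (1 - Z0).
  apply: (@le_trans _ _ (\prod_(w in W) expR (- ((1 - x) * (y w - y w ^+ 2))))).
    apply: ler_prod => w _; apply/andP; split.
      by rewrite addr_ge0 ?mulr_ge0 ?subr_ge0 ?expR_ge0 ?(ltW x0).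
    apply: (@le_trans _ _ (1 + - ((1 - x) * (y w - y w ^+ 2)))); last exact: expR_ge1Dx.
    have := expRN_le_quadratic (y0 w); have := expR_ge0 (- y w); nra.
  by rewrite -expR_sum ler_expR sumrN -mulr_sumr -/Z; lra.
have xk : x ^+ k = (lam ^+ k)^-1 by rewrite exprVn.
have lk0 : 0 < lam ^+ k by rewrite exprn_gt0.
apply: (@le_trans _ _ (\sum_(A : {set 'I_P} | #|A| == s) lam ^+ k * x ^+ hits W S A)).
  apply: ler_sum => A _; case: leqP => hk /=; last by rewrite mulr_ge0 ?exprn_ge0 ?ltW.
  rewrite -ler_pdivrMl // mulr1 -xk; apply: ler_wiXn2l => //; exact: ltW.
rewrite -mulr_sumr -[leRHS]mulrA; apply: ler_wpM2l; first exact: ltW.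
rewrite (_ : 1 + delta - _ = 1 - Z0); last by rewrite /Z0; ring.
have x01 : 0 <= x <= 1 by rewrite ltW.
apply: (@le_trans _ _ (\sum_(A : {set 'I_P} | #|A| == s) [disjoint A & finset.set0]%:R *
   \prod_(w <- enum W) (x + (1 - x) * [disjoint A & piece W S w]%:R))).
  apply: ler_sum => A _; rewrite -finset.setI_eq0 finset.setI0 eqxx mul1r.
  by rewrite big_enum /=; exact: exp_hits_le.
apply: le_trans (sum_prod_avoid_le _ x01 _ _ _) _ => //.
- exact: enum_uniq.
- by move=> i j; rewrite !mem_enum => iW _; exact: piece_disjoint.
- by move=> i _; rewrite -finset.setI_eq0 finset.set0I.
rewrite cards0 mulr0 mul0r oppr0 expR0 mulr1 mulrC; apply: ler_wpM2r => //.
by rewrite big_enum.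
Qed.

End GoodConfigurations.

(** * Failure of robustness *)

Section GoodProbability.
Variables (R : realType) (n P : nat) (D : size_distr R P).
Let mu := objset_prob D.
Let m := size_mean D.
Implicit Types (S : {ffun 'I_n -> {set 'I_P}}) (T : {set 'I_n}).

Lemma rig_probE (E : pred {ffun 'I_n -> {set 'I_P}}) :
  rig_prob D E = pE mu (fun S => (E S)%:R).
Proof.
rewrite /rig_prob /pE big_mkcond; apply: eq_bigr => S _.
by case: (E S); rewrite ?mulr1 ?mulr0.
Qed.

(** Chebyshev's inequality, size by size. *)
Lemma sum_not_near_mean_le eta : 0 < eta * m ->
  \sum_A mu A * (~~ near_mean m eta #|A|)%:R <= size_var D / (eta * m) ^+ 2.
Proof.
move=> em0; rewrite (sum_objset_size D (fun s => (~~ near_mean m eta s)%:R)).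
rewrite /size_var mulr_suml; apply: ler_sum => s _.
rewrite mulrC mulrAC; apply: ler_wpM2r; first exact: Defs.pmf_ge0.
rewrite ler_pdivlMr ?exprn_gt0 //; case: (boolP (near_mean m eta s)) => /= ns.
  by rewrite mul0r sqr_ge0.
move: ns; rewrite /near_mean -ltNge => ns.
by rewrite mul1r -[leRHS]real_normK ?num_real // lerXn2r ?nnegrE ?(ltW em0) ?(ltW ns).
Qed.

(** By independence an object lies in two given sets with probability [(m / P)^2]; summing over [P]
    objects gives [m^2 / P] for each ordered pair of nodes. *)
Lemma pE_overlap_le : (0 < P)%N ->
  pE mu (fun S => (overlap finset.setT S)%:R) <= n%:R ^+ 2 * m ^+ 2 / P%:R.
Proof.
move=> P0; have mu1 := sum_objset_prob D.
have P0R : P%:R != 0 :> R by rewrite pnatr_eq0 -lt0n.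
have eij i j : j != i -> pE mu (fun S => #|S i :&: S j|%:R) = m ^+ 2 / P%:R.
  move=> ji.
  have e S : #|S i :&: S j|%:R = \sum_(a : 'I_P) \prod_(v in [set i; j]) (a \in S v)%:R :> R.
    rewrite -sum1_card natr_sum big_mkcond; apply: eq_bigr => a _.
    rewrite (big_setD1 i) ?inE ?eqxx //= (_ : [set i; j] :\ i = [set j]); last first.
      apply/setP => v; rewrite !inE; case: (eqVneq v i) => //= ->.
      by rewrite eq_sym (negbTE ji).
    by rewrite big_set1 -natrM mulnb; case: (_ && _).
  transitivity (\sum_(a : 'I_P) (m / P%:R) ^+ 2).
    rewrite (eq_pE _ e) pE_sum; apply: eq_bigr => a _.
    rewrite (pE_prod _ (fun _ (A : {set 'I_P}) => (a \in A)%:R)) // sum_objset_mem prodr_const.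
    by rewrite cards2 eq_sym ji.
  rewrite sumr_const card_ord -[_ *+ P]mulr_natl.
  by field.
under eq_pE do rewrite /overlap natr_sum.
rewrite pE_sum.
apply: (@le_trans _ _ (\sum_(i : 'I_n) \sum_(j : 'I_n) m ^+ 2 / P%:R)); last first.
  rewrite !sumr_const !card_ord -mulrnA -[_ *+ (n * n)]mulr_natl natrM.
  by rewrite le_eqVlt; apply/orP; left; apply/eqP; ring.
rewrite big_mkcond; apply: ler_sum => i _; rewrite inE.
under eq_pE do rewrite natr_sum.
rewrite pE_sum big_mkcond; apply: ler_sum => j _; rewrite inE /=.
by case: ifP => [/eij -> //|_]; rewrite divr_ge0 ?sqr_ge0.
Qed.

(** A union bound over the nodes for the sizes, and Markov's inequality for the overlap. *)
Lemma pE_not_good_le eta q : (0 < P)%N -> 0 < eta * m -> 0 < q ->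
  pE mu (fun S => (~~ good m eta q finset.setT S)%:R) <=
  n%:R * (size_var D / (eta * m) ^+ 2) + n%:R ^+ 2 * m ^+ 2 / P%:R / q.
Proof.
move=> P0 em0 q0; have mu1 := sum_objset_prob D.
have mu0 := objset_prob_ge0 D.
apply: (@le_trans _ _ (pE mu (fun S => \sum_(i : 'I_n) (~~ near_mean m eta #|S i|)%:R +
    q^-1 * (overlap finset.setT S)%:R))).
  apply: le_pE => // S; rewrite /good negb_and; case: forallP => /= [_|nf].
    apply: (@le_trans _ _ (q^-1 * (overlap finset.setT S)%:R)); last first.
      by rewrite lerDr sumr_ge0.
    case: (leP (overlap finset.setT S)%:R q) => /= [_|lt]; first by rewrite mulr_ge0 // invr_ge0 ltW.
    by rewrite mulrC ler_pdivlMr // mul1r ltW.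
  have [i] : exists i, ~~ near_mean m eta #|S i|.
    apply/existsP; rewrite -[X in is_true X]negbK negb_exists; apply/negP => /forallP al.
    by apply: nf => i; have := al i; rewrite negbK => ->; rewrite implybT.
  move=> ni; rewrite (bigD1 i) //= ni -addrA lerDl addr_ge0 ?sumr_ge0 // mulr_ge0 //.
  by rewrite invr_ge0 ltW.
rewrite pED pEZ pE_sum; apply: lerD.
  rewrite mulr_natl -[in leRHS](card_ord n) -sumr_const; apply: ler_sum => i _.
  rewrite (pE_marginal i (fun A : {set 'I_P} => (~~ near_mean m eta #|A|)%:R)) //.
  exact: sum_not_near_mean_le.
by rewrite mulrC ler_pM2r ?invr_gt0 // pE_overlap_le.
Qed.

Lemma hits_rig_adj T S v : v \in T ->
  #|[set w in ~: T | rig_adj S v w]| = hits (~: T) S (S v).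
Proof.
move=> vT; apply: eq_card => w; rewrite !inE /rig_adj finset.setI_eq0.
case: (boolP (w \in T)) => //= wT; rewrite (_ : v != w) //.
by apply: contraNneq wT => <-.
Qed.

(** The failing condition is symmetric in [T] and its complement, so the one with at most half of
    the nodes may be taken. *)
Lemma not_robust_few_hits k S : ~~ robust k.+1 (rig_adj S) ->
  exists T : {set 'I_n}, [/\ (0 < #|T|)%N, (2 * #|T| <= n)%N &
    forall v, v \in T -> (hits (~: T) S (S v) <= k)%N].
Proof.
rewrite negb_forall => /existsP[T]; rewrite negb_imply negb_or !negb_exists.
move=> /andP[/andP[T0 Tp] /andP[/forallP ha /forallP hb]].
have cT : (#|T| + #|~: T| = n)%N by rewrite cardsC card_ord.
have [le|gt] := leqP (2 * #|T|) n.
  exists T; rewrite card_gt0; split=> // v vT.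
  have := ha v; rewrite vT /= -ltnNge ltnS; by rewrite hits_rig_adj.
exists (~: T); split; [|by move: cT gt; set x := #|T|; set y := #|~: T|; lia|].
  rewrite card_gt0; apply: contraTneq Tp => e.
  by rewrite -(finset.setCK T) e finset.setC0 fintype.properxx.
move=> v vT; have := hb v; rewrite vT /= -ltnNge ltnS -hits_rig_adj //.
by rewrite finset.setCK.
Qed.

(** Grouping by cardinality leaves a geometric series of first term and ratio [a], at most
    [a / (1 - a) <= 2 a]. *)
Lemma sum_sets_by_card_le (f : nat -> R) (a : R) : 0 <= a <= 2^-1 ->
    (forall t, (0 < t)%N -> (2 * t <= n)%N -> 'C(n, t)%:R * f t <= a ^+ t) ->
  \sum_(T : {set 'I_n} | (0 < #|T|)%N && (2 * #|T| <= n)%N) f #|T| <= 2 * a.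
Proof.
move=> /andP[a0 a1] hf.
have cardP T : (#|T| < n.+1)%N.
  by rewrite ltnS -[X in (_ <= X)%N](card_ord n) max_card.
rewrite (partition_big (fun T => Ordinal (cardP T)) xpredT) //=.
(* The value 0 at [t = 0] reflects the exclusion of the empty set. *)
apply: (@le_trans _ _ (\sum_(t < n.+1) if t == 0%N :> nat then 0 else a ^+ t)).
  apply: ler_sum => t _.
  have [bad|] := boolP ((0 < t)%N && (2 * t <= n)%N); last first.
    move=> bad; rewrite big_pred0 => [|T]; first by case: ifP => // _; rewrite exprn_ge0.
    apply: contraNF bad => /andP[h /eqP e].
    by rewrite -e.
  have /andP[t0 tn] := bad.
  rewrite (eq_bigr (fun=> f t)) => [|T /andP[_ /eqP <-] //].
  rewrite sumr_const (_ : #|_| = 'C(n, t)); last first.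
    rewrite -card_draws_ord; apply: eq_card => T; rewrite !inE.
    apply/andP/eqP => [[_ /eqP <-] //|e]; split; last by apply/eqP/val_inj.
    by rewrite e.
  rewrite -mulr_natl (negbTE (lt0n_neq0 t0)); exact: hf.
rewrite big_ord_recl /= add0r (eq_bigr (fun t : 'I_n => a * a ^+ t)); last first.
  by move=> t _; rewrite exprS.
rewrite -mulr_sumr mulrC; apply: ler_wpM2r => //.
have : \sum_(i < n) a ^+ i * (1 - a) <= 1.
  rewrite -mulr_suml mulrC -opprB mulNr -subrX1 opprB.
  by rewrite lerBlDr lerDl exprn_ge0.
rewrite -mulr_suml -ler_pdivlMr; last lra.
move=> /le_trans; apply; rewrite ler_pdivrMr; lra.
Qed.

Lemma not_robust_le (k : nat) (eta q lam a : R) : (0 < P)%N -> (0 < n)%N ->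
    0 <= m -> 0 <= eta <= 1 -> 0 <= q ->
    lam = n%:R * m ^+ 2 / P%:R -> 1 <= lam ->
    2 * eta * lam + m * q / P%:R + 16 * lam ^+ 2 / n%:R <= 1 ->
    0 <= a <= 2^-1 ->
    (forall t, (0 < t)%N -> (2 * t <= n)%N ->
      'C(n, t)%:R * (lam ^+ k * expR (2 - (n - t)%N%:R / n%:R * lam)) ^+ t <= a ^+ t) ->
  pE mu (fun S => (~~ robust k.+1 (rig_adj S))%:R) <=
  pE mu (fun S => (~~ good m eta q finset.setT S)%:R) + 2 * a.
Proof.
move=> P0 n0 m0 e01 q0 lamE lam1 delta1 a01 ht.
have mu1 := sum_objset_prob D; have mu0 := objset_prob_ge0 D.
(* Goodness is imposed on the outside of [T] only, so that [h T A] is unchanged when the sets inside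
   [T] are redrawn; a globally good configuration satisfies it. *)
pose h T (A : {set 'I_P}) S : R :=
  [&& near_mean m eta #|A|, (hits (~: T) S A <= k)%N & good m eta q (~: T) S]%:R.
pose Q T := (0 < #|T|)%N && (2 * #|T| <= n)%N.
apply: (@le_trans _ _ (pE mu (fun S => (~~ good m eta q finset.setT S)%:R +
    \sum_(T : {set 'I_n} | Q T) \prod_(v in T) h T (S v) S))).
  apply: le_pE => // S.
  have s0 : 0 <= \sum_(T : {set 'I_n} | Q T) \prod_(v in T) h T (S v) S.
    by apply: sumr_ge0 => T _; apply: prodr_ge0.
  have [gS|ngS] := boolP (good m eta q finset.setT S); last first.
    apply: (@le_trans _ _ 1); first by rewrite lern1 leq_b1.
    by rewrite lerDl.
  rewrite add0r; have [_|nr] := boolP (robust _ _); first exact: s0.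
  have [T [T0 Tn hT]] := not_robust_few_hits nr.
  rewrite (bigD1 T) /= ?/Q ?T0 ?Tn // big1 ?lerDl ?sumr_ge0 // => [U _|v vT].
    exact: prodr_ge0.
  rewrite /h hT // (goodS (finset.subsetT _) gS) !andbT.
  by have /andP[/'forall_implyP -> //] := gS; rewrite inE.
rewrite pED lerD2l pE_sum.
pose f t := (lam ^+ k * expR (2 - (n - t)%N%:R / n%:R * lam)) ^+ t.
apply: (@le_trans _ _ (\sum_(T : {set 'I_n} | Q T) f #|T|)); last first.
  exact: sum_sets_by_card_le.
apply: ler_sum => T _; apply: pE_resample_le => //.
  have TC : [disjoint ~: T & T] by rewrite -finset.setI_eq0 finset.setIC finset.setICr.
  by move=> A S S'; rewrite /h (hits_merge _ _ _ TC) (good_merge _ _ _ _ _ TC).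
move=> S; have -> : (n - #|T| = #|~: T|)%N by rewrite [in RHS]cardsCs finset.setCK card_ord.
apply: sum_objset_le => s sP.
have [gS|ngS] := boolP (good m eta q (~: T) S); last first.
  rewrite big1 ?mulr_ge0 ?exprn_ge0 ?expR_ge0 //; first lra.
  by move=> A _; rewrite /h (negbTE ngS) !andbF.
have [ns|nns] := boolP (near_mean m eta s); last first.
  rewrite big1 ?mulr_ge0 ?exprn_ge0 ?expR_ge0 //; first lra.
  by move=> A /eqP e; rewrite /h e (negbTE nns).
have WN : (#|~: T| <= n)%N by rewrite -[X in (_ <= X)%N](card_ord n) max_card.
have := few_hits_le k sP P0 n0 m0 e01 q0 WN lamE lam1 ns gS.
rewrite (eq_bigr (fun A => h T A S)); last first.
  by move=> A /eqP e; rewrite /h e ns gS andbT.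
move=> /le_trans; apply; apply: ler_wpM2r => //; apply: ler_wpM2l.
  by rewrite exprn_ge0 //; lra.
(* The [2] of the exponent is the [1] of [few_hits_le] plus the error terms, assumed at most 1. *)
by rewrite ler_expR; lra.
Qed.

End GoodProbability.

(** * Poisson approximation *)

Section PoissonApproximation.
Variables (R : realType) (n P k : nat) (m eta q lam : R).
Hypotheses (P0 : (0 < P)%N) (n2 : (2 <= n)%N) (k_le : 2 * k%:R <= m).
Hypotheses (m0 : 0 < m) (eta01 : 0 <= eta <= 2^-1) (q0 : 0 <= q).
Hypotheses (lamE : lam = n%:R * m ^+ 2 / P%:R) (lam1 : 1 <= lam).

Definition poisson_cdf : R :=
  \sum_(j < k.+1) lam ^+ j / j`!%:R * expR (- lam).

(* Bounds [lam - (v - j) (s - j) / P] for good configurations: the terms come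
   from the spread of the sizes, the two removed nodes, the overlaps and the
   shift by [j <= k]. *)
Definition err : R :=
  2 * eta * lam + 2 * lam / n%:R + m * q / P%:R + 4 * k%:R * lam / m.

Let P0R : 0 < P%:R :> R. Proof. by rewrite ltr0n. Qed.
Let n0R : 0 < n%:R :> R. Proof. by rewrite ltr0n; case: n n2. Qed.
Let lam0 : 0 < lam. Proof. by move: lam1; lra. Qed.

Let n2R : 2 <= n%:R :> R. Proof. by rewrite ler_nat. Qed.

Lemma near_mean_ge s : near_mean m eta s -> (k <= s)%N.
Proof.
move=> /near_meanP /andP[h _]; rewrite -(ler_nat R).
move: h k_le eta01 m0 => h kl /andP[e0 e1] mm0.
nra.
Qed.

(** [u] stands for the size of the union of the outside sets, [v] for the total size of their
    pieces, [s] for the size of the drawn set. The factor [n - 2] below allows one or two nodes to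
    be set aside. *)
Variables (u v s : nat).
Hypotheses (ns : near_mean m eta s) (sP : (s <= P)%N) (uv : (v <= u)%N).
Hypotheses (v_ge : (n%:R - 2) * ((1 - eta) * m) - q <= v%:R).
Hypotheses (u_le : u%:R <= n%:R * ((1 + eta) * m)).

Let s_bounds := near_meanP ns.
Let ks : (k <= s)%N := near_mean_ge ns.

Let us_le : u%:R + s%:R <= 4 * n%:R * m.
Proof.
have /andP[_ h] := s_bounds; have /andP[e0 e1] := eta01; move: u_le n2R m0 => ul n2' mm0.
have : n%:R * ((1 + eta) * m) <= n%:R * (2 * m) by rewrite ler_pM2l //; nra.
nra.
Qed.

Let vs_le j : (j <= k)%N -> (v%:R * s%:R / P%:R) ^+ j <= lam ^+ j * expR (3 * eta * k%:R).
Proof.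
move=> jk; have /andP[_ h] := s_bounds; have /andP[e0 e1] := eta01.
have vu : v%:R <= n%:R * ((1 + eta) * m) by apply: le_trans u_le; rewrite ler_nat.
have vs : v%:R * s%:R / P%:R <= (1 + 3 * eta) * lam.
  rewrite ler_pdivrMr //.
  have -> : (1 + 3 * eta) * lam * P%:R = (1 + 3 * eta) * (n%:R * m ^+ 2).
    by rewrite lamE; field; rewrite gt_eqF.
  apply: (@le_trans _ _ (n%:R * ((1 + eta) * m) * ((1 + eta) * m))).
    exact: ler_pM.
  have -> : n%:R * ((1 + eta) * m) * ((1 + eta) * m) = (1 + eta) ^+ 2 * (n%:R * m ^+ 2) by ring.
  by apply: ler_wpM2r; [rewrite mulr_ge0 ?sqr_ge0 | nra].
apply: (@le_trans _ _ (((1 + 3 * eta) * lam) ^+ j)).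
  by rewrite lerXn2r ?nnegrE ?divr_ge0 ?mulr_ge0 ?(ltW lam0) //; lra.
rewrite exprMn mulrC; apply: ler_wpM2l; first by rewrite exprn_ge0 // ltW.
apply: (@le_trans _ _ (expR (3 * eta) ^+ j)).
  by rewrite lerXn2r ?nnegrE ?expR_ge0 ?expR_ge1Dx //; lra.
rewrite -expRM_natr ler_expR; apply: ler_wpM2l; first lra.
by rewrite ler_nat.
Qed.

Let vs_ge j : (j <= k)%N -> lam - err <= (v - j)%N%:R * (s - j)%N%:R / P%:R.
Proof.
move=> jk; have /andP[h h'] := s_bounds; have /andP[e0 e1] := eta01.
(* Truncated subtraction of [j] removes at most [k] from each factor. *)
have r1 : v%:R * s%:R - k%:R * (v%:R + s%:R) <= (v - j)%N%:R * (s - j)%N%:R :> R.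
  have kj (a : nat) : 0 <= k%:R - (a%:R - (a - j)%N%:R) :> R.
    by rewrite subr_ge0 lerBlDr -natrD ler_nat -leq_subLR leq_sub2l.
  have jj (a : nat) : 0 <= a%:R - (a - j)%N%:R :> R by rewrite subr_ge0 ler_nat leq_subr.
  have := mulr_ge0 (ler0n R v) (kj s); have := mulr_ge0 (ler0n R s) (kj v).
  have := mulr_ge0 (jj v) (jj s); lra.
have r2 : ((n%:R - 2) * ((1 - eta) * m) - q) * ((1 - eta) * m) <= v%:R * s%:R.
  apply: (@le_trans _ _ (v%:R * ((1 - eta) * m))).
    by apply: ler_wpM2r => //; rewrite mulr_ge0 ?(ltW m0) //; lra.
  exact: ler_wpM2l.
have r3 : v%:R + s%:R <= 4 * n%:R * m.
  by apply: le_trans us_le; rewrite lerD2r ler_nat.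
rewrite ler_pdivlMr //.
have -> : (lam - err) * P%:R = n%:R * m ^+ 2 - (2 * eta * (n%:R * m ^+ 2) + 2 * m ^+ 2
     + m * q + 4 * k%:R * n%:R * m).
  by rewrite /err lamE; field; rewrite !gt_eqF.
have r4 : k%:R * (v%:R + s%:R) <= k%:R * (4 * n%:R * m) by apply: ler_wpM2l.
apply: le_trans r1.
have r5 : (1 - eta) * (m * q) <= m * q.
  by rewrite ler_piMl ?mulr_ge0 ?(ltW m0) //; lra.
have r6 : (1 - 2 * eta) * (n%:R * m ^+ 2) <= (1 - eta) ^+ 2 * (n%:R * m ^+ 2).
  by apply: ler_wpM2r; [rewrite mulr_ge0 ?sqr_ge0 | nra].
have r7 : (1 - eta) ^+ 2 * m ^+ 2 <= m ^+ 2.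
  rewrite ler_piMl ?sqr_ge0 //; nra.
have e : ((n%:R - 2) * ((1 - eta) * m) - q) * ((1 - eta) * m) =
  (1 - eta) ^+ 2 * (n%:R * m ^+ 2) - 2 * ((1 - eta) ^+ 2 * m ^+ 2) - (1 - eta) * (m * q) by ring.
lra.
Qed.

(** Each hypergeometric weight is within a factor [exp (3 eta k + err)] of the Poisson weight: the
    first term comes from the power, the second from the exponential. *)
Lemma hypergeometric_cdf_le tau : 3 * eta * k%:R + err <= tau / 2 -> tau <= 1 ->
    (v <= P)%N ->
  (\sum_(j < k.+1) 'C(v, j) * 'C(P - v, s - j))%N%:R <=
  (1 + tau) * poisson_cdf * 'C(P, s)%:R :> R.
Proof.
move=> htau tau1 vP; rewrite natr_sum /poisson_cdf mulr_sumr mulr_suml.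
apply: ler_sum => j _; have jk : (j <= k)%N by rewrite -ltnS.
rewrite natrM; have jsP : (j <= s <= P)%N by rewrite (leq_trans jk ks).
apply: (le_trans (hypergeometric_le R jsP vP)).
rewrite mulrC; apply: ler_wpM2r => //.
have fj : 0 < j`!%:R :> R by rewrite ltr0n fact_gt0.
apply: (@le_trans _ _ (lam ^+ j * expR (3 * eta * k%:R) / j`!%:R * expR (err - lam))).
  apply: ler_pM; rewrite ?expR_ge0 ?divr_ge0 ?exprn_ge0 ?divr_ge0 //.
    by rewrite ler_pM2r ?invr_gt0 // vs_le.
  by rewrite ler_expR; have := vs_ge jk; lra.
have -> : expR (err - lam) = expR err * expR (- lam) by rewrite expRD.
have -> : lam ^+ j * expR (3 * eta * k%:R) / j`!%:R * (expR err * expR (- lam)) =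
  expR (3 * eta * k%:R + err) * (lam ^+ j / j`!%:R * expR (- lam)).
  by rewrite [expR (_ + err)]expRD; move: (j`!%:R^-1) => f; ring.
apply: ler_wpM2r; first by rewrite mulr_ge0 ?expR_ge0 ?divr_ge0 ?exprn_ge0 ?ltW.
set x := 3 * eta * k%:R + err in htau *.
(* Enough for [exp x <= 1 + tau], because [(1 + tau) (1 - tau / 2) >= 1] for [0 <= tau <= 1]. *)
have hx : 1 - tau / 2 <= expR (- x).
  by apply: le_trans (expR_ge1Dx _); lra.
have ex := expRxMexpNx_1 x; have ex0 := expR_gt0 x.
have tau0 : 0 <= tau.
  have err0 : 0 <= err.
    have /andP[e0 _] := eta01.
    by rewrite /err !addr_ge0 ?divr_ge0 ?mulr_ge0 ?(ltW lam0) ?(ltW m0).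
  have : 0 <= x by rewrite addr_ge0 // !mulr_ge0 //; have /andP[] := eta01.
  lra.
nra.
Qed.

(** Two relative losses are added: [k err] from the power, by Bernoulli's inequality, and
    [3 eta lam + 32 lam^2 / m] from the exponent, where the denominator is [P - u - s] instead of
    [P]. *)
Lemma hypergeometric_cdf_ge tau :
    k%:R * err + (3 * eta * lam + 32 * lam ^+ 2 / m) <= tau -> err <= 1 ->
    8 * lam <= m ->
  (1 - tau) * poisson_cdf * 'C(P, s)%:R <=
  (\sum_(j < k.+1) 'C(v, j) * 'C(P - u, s - j))%N%:R :> R.
Proof.
move=> htau err1 lam8.
have /andP[h h'] := s_bounds; have /andP[e0 e1] := eta01.
have err0 : 0 <= err by rewrite /err !addr_ge0 ?divr_ge0 ?mulr_ge0 ?(ltW lam0) ?(ltW m0).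
have nmP : 4 * n%:R * m = 4 * lam / m * P%:R.
  by rewrite lamE; field; rewrite !gt_eqF.
have lamm : 4 * lam / m <= 2^-1 by rewrite ler_pdivrMr //; lra.
have usP : u%:R + s%:R <= 2^-1 * P%:R :> R.
  by apply: (le_trans us_le); rewrite nmP ler_wpM2r.
have usPn : (u + s < P)%N by rewrite -(ltr_nat R) natrD; move: usP P0R; lra.
(* [kap] bounds [(u + s) / P], the relative shrinking of the denominator. *)
set kap := 4 * lam / m in nmP lamm.
have kap0 : 0 <= kap by rewrite divr_ge0 ?mulr_ge0 ?(ltW lam0) ?(ltW m0).
have expo : s%:R * u%:R / (P - u - s)%N%:R <= lam + (3 * eta * lam + 32 * lam ^+ 2 / m).
  have Pus : (1 - kap) * P%:R <= (P - u - s)%N%:R.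
    rewrite -subnDA natrB ?natrD; last by rewrite ltnW.
    have := us_le; rewrite nmP; lra.
  have Q0 : 0 < (P - u - s)%N%:R :> R by rewrite ltr0n -subnDA subn_gt0.
  rewrite ler_pdivrMr //.
  have su : s%:R * u%:R <= (1 + 3 * eta) * lam * P%:R.
    have -> : (1 + 3 * eta) * lam * P%:R = (1 + 3 * eta) * (n%:R * m ^+ 2).
      by rewrite lamE; field; rewrite gt_eqF.
    apply: (@le_trans _ _ (((1 + eta) * m) * (n%:R * ((1 + eta) * m)))).
      exact: ler_pM.
    have -> : ((1 + eta) * m) * (n%:R * ((1 + eta) * m)) = (1 + eta) ^+ 2 * (n%:R * m ^+ 2) by ring.
    by apply: ler_wpM2r; [rewrite mulr_ge0 ?sqr_ge0 | nra].
  apply: (le_trans su).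
  have -> : 32 * lam ^+ 2 / m = 8 * kap * lam by rewrite /kap; ring.
  have c0 : 0 <= lam + (3 * eta * lam + 8 * kap * lam).
    by have := mulr_ge0 e0 (ltW lam0); have := mulr_ge0 kap0 (ltW lam0); move: lam0; lra.
  apply: (@le_trans _ _ ((lam + (3 * eta * lam + 8 * kap * lam)) * ((1 - kap) * P%:R)));
    last exact: ler_wpM2l.
  rewrite mulrA; apply: ler_wpM2r => //.
  have -> : (lam + (3 * eta * lam + 8 * kap * lam)) * (1 - kap) =
     lam * ((1 + 3 * eta + 8 * kap) * (1 - kap)) by ring.
  rewrite mulrC; apply: ler_wpM2l; first exact: ltW.
  nra.
rewrite natr_sum /poisson_cdf mulr_sumr mulr_suml.
apply: ler_sum => j _; have jk : (j <= k)%N by rewrite -ltnS.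
rewrite natrM; have js : (j <= s)%N by rewrite (leq_trans jk ks).
apply: le_trans (hypergeometric_ge R js uv usPn).
rewrite mulrC; apply: ler_wpM2l => //.
have fj : 0 < j`!%:R :> R by rewrite ltr0n fact_gt0.
set dc := 3 * eta * lam + _ in htau expo.
apply: (@le_trans _ _ ((lam - err) ^+ j / j`!%:R * expR (- (lam + dc)))); last first.
  apply: ler_pM; rewrite ?expR_ge0 ?divr_ge0 ?exprn_ge0 ?subr_ge0 //.
  - by move: err1 lam1; lra.
  - rewrite ler_pM2r ?invr_gt0 // lerXn2r ?nnegrE ?vs_ge ?divr_ge0 ?mulr_ge0 //.
    by rewrite subr_ge0; move: err1 lam1; lra.
  - by rewrite ler_expR lerN2.
have bern : lam ^+ j * (1 - k%:R * err) <= (lam - err) ^+ j.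
  have -> : lam - err = lam * (1 - err / lam) by field; rewrite gt_eqF.
  rewrite exprMn; apply: ler_wpM2l; first by rewrite exprn_ge0 ?ltW.
  have xe : 0 <= err / lam <= 1.
    by rewrite divr_ge0 ?(ltW lam0) //= ler_pdivrMr // mul1r; move: lam1; lra.
  apply: (@le_trans _ _ (1 - j%:R * (err / lam))).
    rewrite lerB // ler_pM ?divr_ge0 ?ler_nat ?(ltW lam0) // ler_pdivrMr // ler_peMr //.
  elim: (nat_of_ord j) => [|i IH]; first by rewrite mul0r subr0 expr0.
  have /andP[x0 x1] := xe; rewrite exprS -natr1.
  have : (1 - err / lam) * (1 - i%:R * (err / lam)) <= (1 - err / lam) * (1 - err / lam) ^+ i.
    by apply: ler_wpM2l => //; lra.
  apply: le_trans.
  have := mulr_ge0 (ler0n R i) (sqr_ge0 (err / lam)).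
  by set x := err / lam; lra.
have dc0 : 0 <= dc by rewrite /dc !addr_ge0 ?divr_ge0 ?mulr_ge0 ?sqr_ge0 ?(ltW lam0) ?(ltW m0).
have -> : expR (- (lam + dc)) = expR (- dc) * expR (- lam) by rewrite opprD expRD mulrC.
have -> : (1 - tau) * (lam ^+ j / j`!%:R * expR (- lam)) =
   (lam ^+ j * (1 - tau)) * (j`!%:R^-1 * expR (- lam)) by ring.
have -> : (lam - err) ^+ j / j`!%:R * (expR (- dc) * expR (- lam)) =
   ((lam - err) ^+ j * expR (- dc)) * (j`!%:R^-1 * expR (- lam)) by ring.
apply: ler_wpM2r; first by rewrite mulr_ge0 ?invr_ge0 ?expR_ge0.
have ed : 1 - dc <= expR (- dc) by exact: expR_ge1Dx.
have ed0 := expR_gt0 (- dc).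
have kerr : 0 <= k%:R * err by rewrite mulr_ge0.
(* If the losses reach 1, so does [tau] and the left side is nonpositive; otherwise
   [(1 - k err) (1 - dc) >= 1 - tau]. *)
have [t1|t1] := leP 1 (k%:R * err + dc).
  apply: (@le_trans _ _ 0); last first.
    by rewrite mulr_ge0 ?expR_ge0 // exprn_ge0 // subr_ge0; move: err1 lam1; lra.
  by rewrite mulr_ge0_le0 ?exprn_ge0 ?(ltW lam0) //; lra.
apply: (@le_trans _ _ (lam ^+ j * (1 - k%:R * err) * expR (- dc))).
  rewrite -mulrA; apply: ler_wpM2l; first by rewrite exprn_ge0 ?ltW.
  nra.
by apply: ler_wpM2r.
Qed.

End PoissonApproximation.

(** * Nodes sharing few objects *)

Section SharedObjects.
Variables (R : realType) (I : finType) (P : nat).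
Implicit Types (W T : {set I}) (S : {ffun I -> {set 'I_P}}) (A B : {set 'I_P}).

(** Unlike [hits], this count with multiplicity can be compared on both sides with the number of
    objects of [A] in the disjoint pieces, which is exactly hypergeometric. *)
Definition shared W S A : nat := (\sum_(w in W) #|A :&: S w|)%N.

Lemma hits_le_shared W S A : (hits W S A <= shared W S A)%N.
Proof.
rewrite /hits -sum1_card /shared big_mkcond [leqRHS]big_mkcond; apply: leq_sum => w _.
by rewrite inE; case: (w \in W) => //=; rewrite -finset.setI_eq0 -card_gt0; case: #|_|.
Qed.

Lemma shared_mono W W' S A : W \subset W' -> (shared W S A <= shared W' S A)%N.
Proof.
move=> /fintype.subsetP WW'; rewrite /shared big_mkcond [leqRHS]big_mkcond.
by apply: leq_sum => w _; case: ifP => // /WW' ->.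
Qed.

Lemma shared_merge W T S S' A : [disjoint W & T] ->
  shared W (merge T S' S) A = shared W S A.
Proof.
by move=> WT; apply: eq_bigr => w wW; rewrite ffunE (disjointFr WT).
Qed.

Let drawn (V Z : {set 'I_P}) (s j : nat) : {set {set 'I_P}} :=
  [set A : {set 'I_P} | [&& A \subset V :|: Z, #|A :&: V| == j & #|A| == s]].

Let card_drawn k s (V Z : {set 'I_P}) : (k <= s)%N -> [disjoint V & Z] ->
  (\sum_(j < k.+1) 'C(#|V|, j) * 'C(#|Z|, s - j) =
   \sum_A \sum_(j < k.+1) (A \in drawn V Z s j))%N.
Proof.
move=> ks VZ; rewrite exchange_big; apply: eq_bigr => j _.
rewrite -card_draws_split //; last by rewrite (leq_trans _ ks) // -ltnS.
by rewrite -sum1_card big_mkcond; apply: eq_bigr => A _; case: (A \in _).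
Qed.

(** Pieces are disjoint parts of the sets, so [A] has at most [shared W S A] objects in their union;
    the right side counts the sets with at most [k] of them. *)
Lemma sum_shared_le k s W S v : (k <= s)%N ->
    v = (\sum_(w in W) #|piece W S w|)%N ->
  \sum_(A : {set 'I_P} | #|A| == s) (shared W S A <= k)%N%:R <=
  (\sum_(j < k.+1) 'C(v, j) * 'C(P - v, s - j))%N%:R :> R.
Proof.
move=> ks vD; pose V := \bigcup_(w in W) piece W S w.
have vE : v = #|V|.
  by rewrite vD card_bigcup_disjoint // => i j iW _; exact: piece_disjoint.
have -> : (P - v = #|~: V|)%N by rewrite vE [in RHS]cardsCs finset.setCK card_ord.
rewrite vE card_drawn //; last by rewrite -finset.setI_eq0 finset.setICr.
rewrite natr_sum big_mkcond; apply: ler_sum => A _.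
case: eqP => // sA; case: (leqP (shared W S A) k) => // sk; rewrite ler_nat.
have AVk : (#|A :&: V| < k.+1)%N.
  rewrite ltnS; apply: leq_trans sk; rewrite /V big_distrr /=.
  apply: leq_trans (leq_card_bigcup _ _) _; apply: leq_sum => w _.
  by rewrite subset_leq_card // finset.setIS // piece_sub.
rewrite (bigD1 (Ordinal AVk)) //= inE finset.setUCr finset.subsetT eqxx sA eqxx.
by [].
Qed.

(* A set lying in the pieces and outside every other [S w] shares each of its
   piece objects with exactly one node. *)
Lemma sum_shared_ge k s W S v u : (k <= s)%N ->
    v = (\sum_(w in W) #|piece W S w|)%N -> u = #|\bigcup_(w in W) S w| ->
  (\sum_(j < k.+1) 'C(v, j) * 'C(P - u, s - j))%N%:R <=
  \sum_(A : {set 'I_P} | #|A| == s) (shared W S A <= k)%N%:R :> R.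
Proof.
move=> ks vD uD; pose V := \bigcup_(w in W) piece W S w.
pose U := \bigcup_(w in W) S w.
have dp : {in W &, forall i j, i != j -> [disjoint piece W S i & piece W S j]}.
  by move=> i j iW _; exact: piece_disjoint.
have vE : v = #|V| by rewrite vD card_bigcup_disjoint.
have -> : (P - u = #|~: U|)%N by rewrite uD [in RHS]cardsCs finset.setCK card_ord.
have VU : V \subset U.
  apply/bigcupsP => w wW; apply: fintype.subset_trans (piece_sub _ _ _) _.
  exact: finset.bigcup_sup.
rewrite vE card_drawn //; last first.
  by rewrite finset.disjoints_subset finset.setCK.
rewrite natr_sum [leRHS]big_mkcond; apply: ler_sum => A _.
have [/existsP[j Aj]|/existsPn no] :=
  boolP [exists j : 'I_k.+1, A \in drawn V (~: U) s j]; last first.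
  rewrite big1 => [|j _]; last by rewrite (negbTE (no j)).
  by case: ifP.
have := Aj; rewrite inE => /and3P[Asub /eqP AV /eqP sA].
(* The classes are disjoint: [A] determines the number of its objects in [V]. *)
have -> : (\sum_(i < k.+1) (A \in drawn V (~: U) s i) = 1)%N.
  rewrite (bigD1 j) //= Aj big1 // => i ij; apply/eqP; rewrite eqb0 inE AV.
  have /negbTE -> : (j != i :> nat) by rewrite eq_sym.
  by rewrite andbF.
rewrite sA eqxx ler_nat lt0b.
apply: leq_trans (_ : #|A :&: V| <= k)%N; last by rewrite AV -ltnS.
rewrite /V big_distrr /= card_bigcup_disjoint; last first.
  move=> i i' iW i'W ii'; apply: fintype.disjointWl (finset.subsetIr _ _) _.
  by apply: fintype.disjointWr (finset.subsetIr _ _) _; exact: dp.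
apply: leq_sum => w wW; rewrite subset_leq_card //; apply/fintype.subsetP => a.
rewrite finset.in_setI => /andP[aA aw]; rewrite finset.in_setI aA /=.
have : a \in V :|: ~: U by apply: (fintype.subsetP Asub).
have aU : a \in U by apply/bigcupP; exists w.
rewrite finset.in_setU finset.in_setC aU orbF => /bigcupP[w' w'W aw'].
case: (eqVneq w w') => [-> //|ww'].
move: aw'; rewrite finset.in_setD => /andP[/bigcupP[]].
by exists w; rewrite ?wW ?ww'.
Qed.

End SharedObjects.

(** * Nodes of low degree and the second moment method *)

Section LowDegree.
Variables (R : realType) (n P k : nat) (D : size_distr R P).
Variables (eta q lam tau : R).
Let mu := objset_prob D.
Let m := size_mean D.
Implicit Types (S : {ffun 'I_n -> {set 'I_P}}) (W T : {set 'I_n}).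

(** Robustness is tested on [[set v]]. If its second alternative holds, a node has more than [k]
    neighbours in a singleton, so [k = 0] and that node is a neighbour of [v]. *)
Lemma robust_many_hits S v : (1 < n)%N -> robust k.+1 (rig_adj S) ->
  (k < hits (~: [set v]) S (S v))%N.
Proof.
move=> n1 /forallP /(_ [set v]).
have -> : [set v] != finset.set0 by rewrite -card_gt0 cards1.
have -> : [set v] \proper finset.setT by rewrite properEcard finset.subsetT cards1 cardsT card_ord.
move=> /= /orP[/existsP[w /andP[]]|/existsP[w /andP[wv]]].
  by rewrite inE => /eqP ->; rewrite hits_rig_adj // inE.
have [e|] := eqVneq [set u in [set v] | rig_adj S w u] finset.set0; first by rewrite e cards0.
move=> /set0Pn[u]; rewrite !inE => /andP[/eqP -> wv'] ks.
have k0 : k = 0%N.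
  have : (#|[set u in [set v] | rig_adj S w u]| <= #|[set v]|)%N.
    by rewrite subset_leq_card //; apply/fintype.subsetP => x; rewrite inE => /andP[].
  by rewrite cards1; move: ks => /leq_trans /[apply]; rewrite ltnS leqn0 => /eqP.
rewrite k0 card_gt0; apply/set0Pn; exists w; rewrite inE wv /=.
by move: wv'; rewrite /rig_adj finset.setI_eq0 disjoint_sym => /andP[].
Qed.

Hypotheses (P0 : (0 < P)%N) (n2 : (2 <= n)%N) (k_le : 2 * k%:R <= m).
Hypotheses (m0 : 0 < m) (eta01 : 0 <= eta <= 2^-1) (q0 : 0 <= q).
Hypotheses (lamE : lam = n%:R * m ^+ 2 / P%:R) (lam1 : 1 <= lam).

Let F := poisson_cdf k lam.
Let er := err n P k m eta q lam.
Hypotheses (tau_up : 3 * eta * k%:R + er <= tau / 2) (tau1 : tau <= 1).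
Hypotheses (tau_lo : k%:R * er + (3 * eta * lam + 32 * lam ^+ 2 / m) <= tau).
Hypotheses (er1 : er <= 1) (lam8 : 8 * lam <= m).

(** Concentration is built into the event, so that the conditional upper bound holds for every
    outside, bad ones contributing 0. *)
Let lowdeg W (A : {set 'I_P}) S : bool :=
  [&& near_mean m eta #|A|, (shared W S A <= k)%N & good m eta q W S].

Let F0 : 0 <= F.
Proof.
apply: sumr_ge0 => j _; rewrite mulr_ge0 ?expR_ge0 // divr_ge0 // exprn_ge0 //.
by move: lam1; lra.
Qed.

Let v_bounds W S : (n - 2 <= #|W|)%N -> good m eta q W S ->
  (n%:R - 2) * ((1 - eta) * m) - q <= (\sum_(w in W) #|piece W S w|)%N%:R.
Proof.
move=> Wn gW; apply: le_trans (good_sum_piece gW); rewrite lerD2r.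
apply: ler_wpM2r; first by rewrite mulr_ge0 ?(ltW m0) //; have /andP[] := eta01; lra.
by rewrite -[2]/(2%:R) -natrB // ler_nat.
Qed.

Let u_bounds W S : good m eta q W S ->
  #|\bigcup_(w in W) S w|%:R <= n%:R * ((1 + eta) * m).
Proof.
move=> /andP[/'forall_implyP nW _].
apply: (@le_trans _ _ (\sum_(w in W) #|S w|)%N%:R); first by rewrite ler_nat leq_card_bigcup.
apply: (@le_trans _ _ (#|W|%:R * ((1 + eta) * m))).
  rewrite natr_sum mulr_natl -sumr_const; apply: ler_sum => w wW.
  by have /andP[] := near_meanP (nW _ wW).
apply: ler_wpM2r; first by rewrite mulr_ge0 ?(ltW m0) //; have /andP[] := eta01; lra.
by rewrite ler_nat -[X in (_ <= X)%N](card_ord n) max_card.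
Qed.

Let v_le_u W S :
  (\sum_(w in W) #|piece W S w| <= #|\bigcup_(w in W) S w|)%N.
Proof.
rewrite -card_bigcup_disjoint; last by move=> i j iW _; exact: piece_disjoint.
rewrite subset_leq_card //; apply/bigcupsP => w wW.
by apply: fintype.subset_trans (piece_sub _ _ _) _; exact: finset.bigcup_sup.
Qed.

Let tau0 : 0 <= tau.
Proof.
have lam0 : 0 <= lam by move: lam1; lra.
have /andP[e0 _] := eta01.
have er0 : 0 <= er by rewrite /er /err !addr_ge0 ?divr_ge0 ?mulr_ge0 ?(ltW m0).
have : 0 <= 3 * eta * k%:R by rewrite !mulr_ge0.
by move: tau_up; lra.
Qed.

Lemma sum_lowdeg_le W S : (n - 2 <= #|W|)%N ->
  \sum_A mu A * (lowdeg W A S)%:R <= (1 + tau) * F.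
Proof.
move=> Wn; have C0 : 0 <= (1 + tau) * F by rewrite mulr_ge0 ?F0 //; move: tau0; lra.
apply: sum_objset_le => s sP.
have [gW|ngW] := boolP (good m eta q W S); last first.
  rewrite big1 => [|A _]; last by rewrite /lowdeg (negbTE ngW) !andbF.
  by rewrite mulr_ge0.
have [ns|nns] := boolP (near_mean m eta s); last first.
  rewrite big1 => [|A /eqP e]; last by rewrite /lowdeg e (negbTE nns).
  by rewrite mulr_ge0.
rewrite (eq_bigr (fun A => (shared W S A <= k)%N%:R)); last first.
  by move=> A /eqP e; rewrite /lowdeg e ns gW andbT.
have ks := near_mean_ge k_le m0 eta01 ns.
apply: (le_trans (sum_shared_le R ks erefl)).
apply: (hypergeometric_cdf_le P0 n2 k_le m0 eta01 q0 lamE lam1 ns sP (v_le_u W S)) => //.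
- exact: v_bounds.
- exact: u_bounds.
- rewrite (leq_trans (v_le_u W S)) // -[X in (_ <= X)%N](card_ord P); exact: max_card.
Qed.

Lemma sum_lowdeg_ge W S : (n - 2 <= #|W|)%N -> good m eta q W S ->
  (1 - tau) * F * (\sum_A mu A * (near_mean m eta #|A|)%:R) <=
  \sum_A mu A * (lowdeg W A S)%:R.
Proof.
move=> Wn gW; apply: (@sum_objset_ge R P D _ (near_mean m eta)) => // s sP ns.
have ks := near_mean_ge k_le m0 eta01 ns.
rewrite (eq_bigr (fun A => (shared W S A <= k)%N%:R)); last first.
  by move=> A /eqP e; rewrite /lowdeg e ns gW andbT.
apply: le_trans (sum_shared_ge R ks erefl erefl).
apply: (hypergeometric_cdf_ge P0 n2 k_le m0 eta01 q0 lamE lam1 ns (v_le_u W S)) => //.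
- exact: v_bounds.
- exact: u_bounds.
Qed.

(** The second moment bound centred at [M = n F], the approximate number of low-degree nodes; [beta]
    bounds the probability of a bad configuration. *)
Lemma robust_le beta : 0 <= beta <= 1 ->
    pE mu (fun S => (~~ good m eta q finset.setT S)%:R) <= beta -> 0 < F ->
  pE mu (fun S => (robust k.+1 (rig_adj S))%:R) <=
  5 * tau + 4 * beta + 2 / (n%:R * F).
Proof.
move=> /andP[b0 b1] hbeta Fpos.
have mu1 := sum_objset_prob D; have mu_ge0 := objset_prob_ge0 D.
have n0R : 0 < n%:R :> R by rewrite ltr0n; case: n n2.
have pgood : 1 - beta <= pE mu (fun S => (good m eta q finset.setT S)%:R).
  have : pE mu (fun S : {ffun 'I_n -> _} => (good m eta q finset.setT S)%:R +
      (~~ good m eta q finset.setT S)%:R) = 1.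
    rewrite -[RHS](@pE_cst R 'I_n {set 'I_P} mu 1 mu1); apply: eq_pE => S.
    by case: (good _ _ _ _ _); rewrite ?addr0 ?add0r.
  by rewrite pED; move: hbeta; lra.
pose B v S := lowdeg (~: [set v]) (S v) S.
have merge1 T W A S S' : [disjoint W & T] ->
    (lowdeg W A (merge T S' S))%:R = (lowdeg W A S)%:R :> R.
  by move=> WT; rewrite /lowdeg (shared_merge _ _ _ WT) (good_merge _ _ _ _ _ WT).
have TC T : [disjoint ~: T & T] by rewrite -finset.setI_eq0 finset.setIC finset.setICr.
have c1 (v : 'I_n) : (n - 2 <= #|~: [set v]|)%N.
  by rewrite [X in (_ <= X)%N]cardsCs finset.setCK cards1 card_ord leq_sub2l.
have pB v : pE mu (fun S => (B v S)%:R) <= (1 + tau) * F.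
  have := pE_resample_le (T := [set v]) (h := fun A S => (lowdeg (~: [set v]) A S)%:R) mu_ge0 mu1.
  move=> /(_ ((1 + tau) * F)); rewrite cards1 expr1.
  under eq_pE do rewrite big_set1.
  by apply=> // [A S S'|S]; [exact: merge1 | exact: sum_lowdeg_le].
have t1 : 0 <= 1 - tau by rewrite subr_ge0.
have bb : 0 <= 1 - beta by rewrite subr_ge0.
(* One factor [1 - beta] pays for a good outside, the other for the size of the redrawn set being
   near the mean. *)
have loB v : (1 - tau) * F * (1 - beta) ^+ 2 <= pE mu (fun S => (B v S)%:R).
  have -> : pE mu (fun S => (B v S)%:R) =
      pE mu (fun S => \sum_A mu A * (lowdeg (~: [set v]) A S)%:R).
    have := @pE_resample R _ _ mu [set v] (fun A S => (lowdeg (~: [set v]) A S)%:R) mu1.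
    move=> /(_ (fun A S S' => merge1 _ _ A S S' (TC [set v]))).
    by under eq_pE do rewrite big_set1; under [in RHS]eq_pE do rewrite big_set1.
  have pnear : 1 - beta <= \sum_A mu A * (near_mean m eta #|A|)%:R.
    rewrite -(pE_marginal v (fun A : {set 'I_P} => (near_mean m eta #|A|)%:R) mu1).
    apply: (le_trans pgood); apply: le_pE => // S; rewrite ler_nat.
    case: (boolP (good _ _ _ _ _)) => // /andP[/'forall_implyP nS _].
    by rewrite nS // inE.
  have -> : (1 - tau) * F * (1 - beta) ^+ 2 = (1 - tau) * F * (1 - beta) * (1 - beta) by ring.
  apply: (@le_trans _ _ ((1 - tau) * F * (1 - beta) *
      pE mu (fun S => (good m eta q finset.setT S)%:R))).
    by apply: ler_wpM2l => //; rewrite !mulr_ge0.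
  rewrite -pEZ; apply: le_pE => // S.
  have [gS|_] := boolP (good _ _ _ _ _); last first.
    by rewrite mulr0 sumr_ge0 // => A _; rewrite mulr_ge0.
  rewrite mulr1; apply: le_trans (sum_lowdeg_ge (c1 v) (goodS (finset.subsetT _) gS)).
  by apply: ler_wpM2l => //; rewrite mulr_ge0.
have lowdegS W W' A S : W \subset W' -> lowdeg W' A S -> lowdeg W A S.
  move=> WW' /and3P[na sh gd]; apply/and3P; split=> //; last exact: goodS gd.
  exact: leq_trans (shared_mono _ _ WW') sh.
(* [lowdeg] weakens when [W] shrinks, so both nodes can be tested against the complement of
   [[set u; v]] and redrawn together. *)
have pBB u v : u != v -> pE mu (fun S => (B u S && B v S)%:R) <= ((1 + tau) * F) ^+ 2.
  move=> uv; have c2 : #|[set u; v]| = 2%N by rewrite cards2 uv.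
  have c2' : (n - 2 <= #|~: [set u; v]|)%N.
    by rewrite [X in (_ <= X)%N]cardsCs finset.setCK c2 card_ord.
  rewrite -c2; apply: le_trans (pE_resample_le
    (h := fun A S => (lowdeg (~: [set u; v]) A S)%:R) mu_ge0 mu1 _ _ _).
  - apply: le_pE => // S; case: (boolP (B u S && B v S)) => [/andP[Bu Bv]|_]; last exact: prodr_ge0.
    rewrite big1 // => w; rewrite !inE => /orP[] /eqP ->.
      by rewrite (lowdegS _ _ _ _ _ Bu) // finset.setCS finset.sub1set !inE eqxx.
    by rewrite (lowdegS _ _ _ _ _ Bv) // finset.setCS finset.sub1set !inE eqxx orbT.
  - by move=> A S S'; exact: merge1.
  - by [].
  - by move=> S; exact: sum_lowdeg_le.
have M0 : 0 < n%:R * F by rewrite mulr_gt0.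
apply: (@le_trans _ _ (pE mu (fun S => [forall v, ~~ B v S]%:R))).
  apply: le_pE => // S; rewrite ler_nat; case: (boolP (robust _ _)) => // rS.
  rewrite lt0b; apply/forallP => v; apply/negP => /and3P[_ sh _].
  have := robust_many_hits v n2 rS; rewrite ltnNge.
  by rewrite (leq_trans (hits_le_shared _ _ _) sh).
apply: (le_trans (second_moment mu_ge0 mu1 M0 pB loB pBB)).
rewrite card_ord; set M := n%:R * F in M0 *.
have -> : n%:R * ((1 + tau) * F) = (1 + tau) * M by rewrite /M; ring.
have -> : n%:R * ((1 - tau) * F * (1 - beta) ^+ 2) = (1 - tau) * (1 - beta) ^+ 2 * M by rewrite /M; ring.
rewrite ler_pdivrMr ?exprn_gt0 //.
have -> : (5 * tau + 4 * beta + 2 / M) * M ^+ 2 = (5 * tau + 4 * beta) * M ^+ 2 + 2 * M.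
  by field; rewrite gt_eqF.
(* The coefficient of [M ^+ 2] is at most [4 tau + tau^2 + 4 beta], and the linear term is at most
   [2 M]. *)
have -> : (1 + tau) * M + ((1 + tau) * M) ^+ 2 - 2 * M * ((1 - tau) * (1 - beta) ^+ 2 * M) + M ^+ 2 =
  (1 + tau) * M + ((1 + tau) ^+ 2 - 2 * ((1 - tau) * (1 - beta) ^+ 2) + 1) * M ^+ 2 by ring.
rewrite addrC; apply: lerD; last by rewrite ler_pM2r //; lra.
apply: ler_wpM2r; first exact: sqr_ge0.
have : (1 - tau) * (1 - 2 * beta) <= (1 - tau) * (1 - beta) ^+ 2.
  by apply: ler_wpM2l => //; nra.
move: tau0 => tau0' h.
have : (1 - tau) * (1 - 2 * beta) >= 1 - tau - 2 * beta by nra.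
nra.
Qed.

End LowDegree.

(** * The asymptotic regime *)

Section Regime.
(** [K] is [k - 1], [eps] the accuracy aimed at, and [c] the constant in the lower bound on the
    mean. For fixed [eps] the inequalities on [L] and [n] below hold for all large [n]. *)
Variables (R : realType) (K n P : nat) (D : size_distr R P) (alpha eps c : R).
Let m := size_mean D.
Let L : R := ln n%:R.
Let lam : R := n%:R * m ^+ 2 / P%:R.
(* [eta] is the relative spread for which Chebyshev's inequality and a union
   bound over the nodes cost [eps]; [q] is the overlap that changes the expected
   degree [lam] of a node by at most [O(eps)]. *)
Let eta : R := eps / L.
Let q : R := eps * n%:R * m / L.
Let mu := objset_prob D.

Hypotheses (P0 : (0 < P)%N) (n2 : (2 <= n)%N).
Hypotheses (eps0 : 0 < eps) (eps_le : (14 + 6 * K%:R) * eps <= 1) (c0 : 0 < c).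
Hypothesis mean_eq :
  m ^+ 2 / P%:R = (L + K%:R * ln L + alpha) / n%:R.
Hypothesis mean_ge : c * L ^+ 3 <= m.
Hypothesis var_le : size_var D <= eps ^+ 3 * (m ^+ 2 / (n%:R * L ^+ 2)).
Hypotheses (alpha_le : `|alpha| <= L / 8) (lnL_le : K%:R * ln L <= L / 8).
Hypotheses (L_ge : 30 + 3 * K%:R <= L) (cL_ge : 50 + 5 * K%:R <= c * eps ^+ 2 * L).
Hypothesis n_ge : 25 * L ^+ 2 <= eps * n%:R.

Let K0 : 0 <= K%:R :> R. Proof. by []. Qed.
Let P0R : 0 < P%:R :> R. Proof. by rewrite ltr0n. Qed.
Let n0R : 0 < n%:R :> R. Proof. by rewrite ltr0n; case: n n2. Qed.
Let L30 : 30 <= L. Proof. by have := K0; move: L_ge; lra. Qed.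
Let L0 : 0 < L. Proof. by have := L30; lra. Qed.
Let eps14 : eps <= 14^-1. Proof. by have := mulr_ge0 K0 (ltW eps0); move: eps_le; lra. Qed.

Let lamE : lam = L + K%:R * ln L + alpha.
Proof.
have -> : lam = n%:R * (m ^+ 2 / P%:R) by rewrite /lam mulrA.
by rewrite mean_eq; field; rewrite gt_eqF.
Qed.

Let lam_bounds : 3 / 4 * L <= lam <= 5 / 4 * L.
Proof.
have : 0 <= ln L by apply: ln_ge0; have := L30; lra.
move=> /(mulr_ge0 K0) h; rewrite lamE; move: alpha_le lnL_le.
by rewrite ler_norml => /andP[]; lra.
Qed.

Let lam1 : 1 <= lam. Proof. by have /andP[] := lam_bounds; have := L30; lra. Qed.
Let lam0 : 0 < lam. Proof. by have := lam1; lra. Qed.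

Let cL : 50 + 5 * K%:R <= c * eps * L.
Proof.
apply: (le_trans cL_ge).
have -> : c * eps ^+ 2 * L = eps * (c * eps * L) by ring.
have h : 0 < c * eps * L by rewrite !mulr_gt0 ?L0.
by rewrite ler_piMl ?(ltW h) //; have := eps14; lra.
Qed.

Let m_ge : (50 + 5 * K%:R) * L ^+ 2 <= eps * m.
Proof.
apply: (@le_trans _ _ (eps * (c * L ^+ 3))); last by rewrite ler_pM2l.
have -> : eps * (c * L ^+ 3) = (c * eps * L) * L ^+ 2 by ring.
by apply: ler_wpM2r; rewrite ?sqr_ge0 ?cL.
Qed.

Let m0 : 0 < m.
Proof.
apply: lt_le_trans mean_ge; rewrite mulr_gt0 // exprn_gt0 //; exact: L0.
Qed.

Let L2 : 30 * L <= L ^+ 2.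
Proof. by rewrite expr2 ler_pM2r ?L0 ?L30. Qed.

Let eta01 : 0 <= eta <= 2^-1.
Proof.
rewrite divr_ge0 ?(ltW eps0) ?(ltW L0) //= ler_pdivrMr ?L0 //.
by have := eps14; have := L30; lra.
Qed.

Let q0 : 0 < q. Proof. by rewrite divr_gt0 ?mulr_gt0 ?L0 ?m0. Qed.

Let mq_le : m * q / P%:R <= 5 / 4 * eps.
Proof.
have -> : m * q / P%:R = eps * (lam / L).
  by rewrite /q /lam; field; rewrite !gt_eqF ?L0.
rewrite mulrC ler_pM2r // ler_pdivrMr ?L0 //.
by have /andP[] := lam_bounds.
Qed.

Let etalam : eta * lam <= 5 / 4 * eps.
Proof.
have -> : eta * lam = eps * (lam / L) by rewrite /eta; ring.
rewrite mulrC ler_pM2r // ler_pdivrMr ?L0 //.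
by have /andP[] := lam_bounds.
Qed.

Let lam2_le : lam ^+ 2 <= 25 / 16 * L ^+ 2.
Proof.
have -> : 25 / 16 * L ^+ 2 = (5 / 4 * L) ^+ 2 by field.
have /andP[_ h] := lam_bounds.
by rewrite lerXn2r ?nnegrE ?(ltW lam0) ?mulr_ge0 ?(ltW L0).
Qed.

(** The variance term is exactly [eps] by the choice of [eta]; the overlap term is
    [lam L / (eps m)], at most [eps] because [m] is at least of order [L^3]. *)
Lemma regime_not_good_le :
  pE mu (fun S : {ffun 'I_n -> {set 'I_P}} =>
    (~~ good m eta q finset.setT S)%:R) <= 2 * eps.
Proof.
have em0 : 0 < eta * m by rewrite mulr_gt0 ?m0 // divr_gt0 ?L0.
apply: (le_trans (pE_not_good_le n P0 em0 q0)).
have -> : 2 * eps = eps + eps by ring.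
apply: lerD.
  apply: (@le_trans _ _ (n%:R * (eps ^+ 3 * (m ^+ 2 / (n%:R * L ^+ 2)) / (eta * m) ^+ 2))).
    by rewrite ler_pM2l // ler_pM2r // invr_gt0 exprn_gt0.
  rewrite le_eqVlt; apply/orP; left; apply/eqP; rewrite /eta.
  by field; rewrite !gt_eqF ?L0 ?m0.
have -> : n%:R ^+ 2 * m ^+ 2 / P%:R / q = lam * L / (eps * m).
  by rewrite /q /lam; field; rewrite !gt_eqF ?L0 ?m0.
rewrite ler_pdivrMr ?mulr_gt0 ?m0 //.
apply: (@le_trans _ _ (5 / 4 * L ^+ 2)).
  have -> : 5 / 4 * L ^+ 2 = (5 / 4 * L) * L by ring.
  by rewrite ler_pM2r ?L0 //; have /andP[] := lam_bounds.
apply: (@le_trans _ _ (c * eps ^+ 2 * L ^+ 3)).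
  have -> : c * eps ^+ 2 * L ^+ 3 = c * eps ^+ 2 * L * L ^+ 2 by ring.
  by apply: ler_wpM2r; rewrite ?sqr_ge0 //; have := K0; move: cL_ge; lra.
have -> : c * eps ^+ 2 * L ^+ 3 = eps ^+ 2 * (c * L ^+ 3) by ring.
have -> : eps * (eps * m) = eps ^+ 2 * m by ring.
by apply: ler_wpM2l; rewrite ?sqr_ge0.
Qed.

(** The source of the threshold: in [exp (- lam)] the summand [L] cancels [n], and [K ln L] turns
    [lam ^+ K] into a power of [lam / L]. *)
Let lam_exp : n%:R * (lam ^+ K * expR (- lam)) = (lam / L) ^+ K * expR (- alpha).
Proof.
have -> : expR (- lam) = n%:R^-1 * (L ^+ K)^-1 * expR (- alpha).
  rewrite lamE !opprD !expRD !expRN lnK ?posrE // expRM_natl lnK ?posrE ?L0 //.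
rewrite (expr_div_n lam L); move: (exprn_gt0 K L0) (expR (- alpha)) => LK e.
move: (L ^+ K) (lam ^+ K) LK => x y x0.
by field; rewrite !gt_eqF.
Qed.

Let ratio_bounds : 2^-1 <= lam / L <= 2.
Proof.
have /andP[l1 l2] := lam_bounds; have := L0 => LL.
by rewrite ler_pdivlMr // ler_pdivrMr //; apply/andP; split; lra.
Qed.

(** From ['C(n, t) <= n^t / t!] and [t^t / t! <= exp t]. *)
Let bin_le_exp t : (0 < t)%N -> 'C(n, t)%:R <= (n%:R * expR 1 / t%:R) ^+ t :> R.
Proof.
move=> t0; have t0R : 0 < t%:R :> R by rewrite ltr0n.
have ft : 0 < t`!%:R :> R by rewrite ltr0n fact_gt0.
apply: (@le_trans _ _ (n%:R ^+ t / t`!%:R)).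
  by rewrite ler_pdivlMr // -natrM bin_ffact ffact_le_exp.
rewrite -mulrA exprMn; apply: ler_wpM2l; first by rewrite exprn_ge0.
rewrite expr_div_n -expRM_natl mulr1 ler_pdivlMr ?exprn_gt0 // mulrC.
case: t t0 t0R ft => // t _ t0R ft.
apply: (@le_trans _ _ (1 + t.+1%:R ^+ t.+1 / t.+1`!%:R)); first by rewrite lerDr.
by apply: expR_ge1Dxn.
Qed.

(** For [t <= n / (2 L)] the exponent is at most 1. For larger [t], [2 t <= n] bounds the
    exponential by [n^(5/8)], which is below [n / (2 L) < t]. *)
Let exp_over_t t : (0 < t)%N -> (2 * t <= n)%N ->
  expR (t%:R * lam / n%:R) / t%:R <= expR 1.
Proof.
move=> t0 tn; have t0R : 0 < t%:R :> R by rewrite ltr0n.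
have t1R : 1 <= t%:R :> R by rewrite ler1n.
have /andP[l1 l2] := lam_bounds; have LL := L0.
rewrite ler_pdivrMr //.
have [small|big] := leP (2 * L * t%:R) n%:R.
  apply: (@le_trans _ _ (expR 1)); last by rewrite ler_peMr ?expR_ge0.
  rewrite ler_expR ler_pdivrMr // mul1r; apply: le_trans small.
  by rewrite mulrC ler_pM2r //; lra.
apply: (@le_trans _ _ (expR (5 / 8 * L))).
  rewrite ler_expR ler_pdivrMr //.
  have h : 2 * t%:R <= n%:R :> R by rewrite -natrM ler_nat.
  apply: (@le_trans _ _ (t%:R * (5 / 4 * L))); first by rewrite ler_pM2l.
  nra.
apply: (@le_trans _ _ t%:R); last by rewrite ler_peMl ?ltW // -expR0 ltr_expR.
rewrite -(ler_pM2l (_ : 0 < 2 * L)); last by rewrite mulr_gt0.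
apply: le_trans (ltW big).
have nE : n%:R = expR (5 / 8 * L) * expR (3 / 8 * L) :> R.
  rewrite -expRD (_ : _ + _ = L); last by field.
  by rewrite lnK ?posrE.
rewrite nE mulrC ler_pM2l ?expR_gt0 //.
(* The quadratic term of the exponential gives [2 L <= n^(3/8)] once [L >= 30]. *)
have h0 : 0 <= 3 / 8 * L by lra.
have := expR_ge1Dxn 1 h0; apply: le_trans.
have -> : (2`!)%:R = 2 :> R by [].
have := L30; nra.
Qed.

Lemma regime_not_robust_le :
    expR 4 * 2 ^+ K * expR (- alpha) <= eps ->
  rig_robust_prob K.+1 n D >= 1 - 4 * eps.
Proof.
(* In [a], [expR 4] gathers one [e] from the binomial coefficient, two from [not_robust_le] and one
   from [exp_over_t]; [2 ^+ K] bounds [(lam / L) ^+ K]. *)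
move=> halpha; set a := _ * expR (- alpha) in halpha.
have a0 : 0 <= a by rewrite !mulr_ge0 ?expR_ge0.
have mu1 := sum_objset_prob D.
have e01 : 0 <= eta <= 1 by have /andP[e0 e1] := eta01; apply/andP; split=> //; lra.
have nr : pE mu (fun S : {ffun 'I_n -> {set 'I_P}} => (~~ robust K.+1 (rig_adj S))%:R) <=
    2 * eps + 2 * a.
  have dle : 2 * eta * lam + m * q / P%:R + 16 * lam ^+ 2 / n%:R <= 1.
    have h1 : 16 * lam ^+ 2 / n%:R <= eps.
      by rewrite ler_pdivrMr //; move: n_ge; have := lam2_le; lra.
    by have := mq_le; have := etalam; have := eps14; lra.
  have a01 : 0 <= a <= 2^-1 by rewrite a0 /=; have := eps14; lra.
  have n0 : (0 < n)%N by case: n n2.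
  apply: (le_trans (not_robust_le P0 n0 (ltW m0) e01 (ltW q0) erefl lam1 dle a01 _)).
    move=> t t0 tn; have t0R : 0 < t%:R :> R by rewrite ltr0n.
    apply: (@le_trans _ _ ((n%:R * expR 1 / t%:R) ^+ t *
       (lam ^+ K * expR (2 - (n - t)%N%:R / n%:R * lam)) ^+ t)).
      apply: ler_wpM2r; last exact: bin_le_exp.
      by rewrite exprn_ge0 // mulr_ge0 ?expR_ge0 // exprn_ge0 // ltW // lam0.
    rewrite -exprMn; apply: lerXn2r; rewrite ?nnegrE ?a0 //.
      by rewrite !mulr_ge0 ?expR_ge0 ?invr_ge0 ?exprn_ge0 ?(ltW lam0).
    have -> : 2 - (n - t)%N%:R / n%:R * lam = 2 + t%:R * lam / n%:R - lam.
      rewrite natrB; last by rewrite (leq_trans _ tn) // leq_pmull.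
      by field; rewrite gt_eqF.
    rewrite (expRD (2 + t%:R * lam / n%:R) (- lam)) (expRD 2 (t%:R * lam / n%:R)).
    have -> : n%:R * expR 1 / t%:R *
        (lam ^+ K * (expR 2 * expR (t%:R * lam / n%:R) * expR (- lam))) =
      expR 1 * expR 2 * (expR (t%:R * lam / n%:R) / t%:R) *
        (n%:R * (lam ^+ K * expR (- lam))).
      by field; rewrite gt_eqF.
    rewrite lam_exp /a mulrA; apply: ler_wpM2r; first exact: expR_ge0.
    have /andP[r1 r2] := ratio_bounds.
    apply: ler_pM.
    - by rewrite !mulr_ge0 ?expR_ge0 ?invr_ge0.
    - by rewrite exprn_ge0 // (le_trans _ r1) // invr_ge0.
    - have -> : (4 : R) = 1 + 2 + 1 by ring.
      rewrite (expRD (1 + 2) 1) (expRD 1 2); apply: ler_wpM2l; first by rewrite mulr_ge0 ?expR_ge0.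
      exact: exp_over_t.
    - by apply: lerXn2r; rewrite ?nnegrE // (le_trans _ r1) // invr_ge0.
  by rewrite lerD2r; exact: regime_not_good_le.
rewrite /rig_robust_prob rig_probE -/mu.
have : pE mu (fun S : {ffun 'I_n -> {set 'I_P}} => (robust K.+1 (rig_adj S))%:R +
    (~~ robust K.+1 (rig_adj S))%:R) = 1.
  rewrite -[RHS](@pE_cst R 'I_n {set 'I_P} mu 1 mu1); apply: eq_pE => S.
  by case: (robust _ _); rewrite ?addr0 ?add0r.
by rewrite pED; move: nr halpha; lra.
Qed.

(** The last term of the Poisson sum already makes [n F] of order [exp (- alpha)]. The constant is
    [5 (14 + 6 K)] from [tau], 8 from [beta = 2 eps] and 1 from [2 / (n F)]. *)
Lemma regime_robust_le : 2 ^+ K.+1 * K`!%:R * expR alpha <= eps ->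
  rig_robust_prob K.+1 n D <= (79 + 30 * K%:R) * eps.
Proof.
move=> halpha; set tau := (14 + 6 * K%:R) * eps.
rewrite /rig_robust_prob rig_probE -/mu.
have /andP[l1 l2] := lam_bounds; have LL := L0; have mm := m0; have le2 := L2.
have Ke : 0 <= K%:R * eps by rewrite mulr_ge0 // ltW.
have KL2 : 0 <= K%:R * L ^+ 2 by rewrite mulr_ge0 // sqr_ge0.
have er : err n P K m eta q lam <= 6 * eps.
  have h1 : 2 * lam / n%:R <= eps.
    by rewrite ler_pdivrMr //; move: n_ge; lra.
  have h2 : 4 * K%:R * lam / m <= eps.
    rewrite ler_pdivrMr //; apply: le_trans m_ge.
    have : K%:R * lam <= K%:R * (5 / 4 * L) by apply: ler_wpM2l.
    have : K%:R * (30 * L) <= K%:R * L ^+ 2 by apply: ler_wpM2l.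
    have := sqr_ge0 L; lra.
  by rewrite /err; have := mq_le; have := etalam; move: eps0; lra.
have K3 : 3 * eta * K%:R <= eps.
  have -> : 3 * eta * K%:R = eps * (3 * K%:R) / L by rewrite /eta; ring.
  by rewrite ler_pdivrMr // ler_pM2l //; move: L_ge; lra.
have kl : 2 * K%:R <= m.
  have : eps * m <= m by rewrite ler_piMl ?(ltW mm) //; have := eps14; lra.
  have := m_ge; move: L_ge; lra.
have lam8 : 8 * lam <= m.
  have : eps * m <= m by rewrite ler_piMl ?(ltW mm) //; have := eps14; lra.
  have := m_ge; lra.
have tup : 3 * eta * K%:R + err n P K m eta q lam <= tau / 2.
  by rewrite /tau; lra.
have tlo : K%:R * err n P K m eta q lam + (3 * eta * lam + 32 * lam ^+ 2 / m) <= tau.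
  have h1 : 32 * lam ^+ 2 / m <= eps.
    rewrite ler_pdivrMr //; apply: le_trans m_ge; have := lam2_le; lra.
  have h2 : K%:R * err n P K m eta q lam <= K%:R * (6 * eps) by apply: ler_wpM2l.
  by have := etalam; rewrite /tau; move: eps0; lra.
have er1 : err n P K m eta q lam <= 1 by have := eps14; move: eps0; lra.
have Fge : lam ^+ K / K`!%:R * expR (- lam) <= poisson_cdf K lam.
  rewrite /poisson_cdf big_ord_recr /= lerDr sumr_ge0 // => j _.
  by rewrite mulr_ge0 ?expR_ge0 // divr_ge0 // exprn_ge0 // ltW // lam0.
have fK : 0 < K`!%:R :> R by rewrite ltr0n fact_gt0.
have T0 : 0 < lam ^+ K / K`!%:R * expR (- lam).
  by rewrite mulr_gt0 ?expR_gt0 // divr_gt0 // exprn_gt0 // lam0.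
have F0 : 0 < poisson_cdf K lam by exact: lt_le_trans Fge.
have b01 : 0 <= 2 * eps <= 1 by have := eps14; move: eps0; lra.
have := robust_le P0 n2 kl m0 eta01 (ltW q0) erefl lam1 tup eps_le tlo er1 lam8 b01
  regime_not_good_le F0.
move=> /le_trans; apply.
have M : 2 / (n%:R * poisson_cdf K lam) <= eps.
  apply: le_trans halpha.
  rewrite ler_pdivrMr ?mulr_gt0 //.
  apply: (@le_trans _ _ (2 ^+ K.+1 * K`!%:R * expR alpha *
      (n%:R * (lam ^+ K / K`!%:R * expR (- lam))))); last first.
    by rewrite ler_pM2l ?ler_pM2l // !mulr_gt0 ?expR_gt0 ?exprn_gt0.
  have -> : n%:R * (lam ^+ K / K`!%:R * expR (- lam)) =
     (n%:R * (lam ^+ K * expR (- lam))) / K`!%:R by field; rewrite gt_eqF.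
  rewrite lam_exp.
  have -> : 2 ^+ K.+1 * K`!%:R * expR alpha * ((lam / L) ^+ K * expR (- alpha) / K`!%:R) =
     2 * ((2 * (lam / L)) ^+ K) * (expR alpha * expR (- alpha)).
    rewrite (exprS _ K) (exprMn _ 2 (lam / L)).
    move: (2 ^+ K) ((lam / L) ^+ K) (expR alpha) (expR (- alpha)) => x y z t.
    by field; rewrite gt_eqF.
  rewrite expRxMexpNx_1 mulr1 ler_peMr // exprn_ege1 //.
  by have /andP[r1 _] := ratio_bounds; lra.
by rewrite /tau; move: eps0; lra.
Qed.

End Regime.

(** * From explicit bounds to limits *)

Local Open Scope classical_set_scope.
Local Open Scope ring_scope.

Section Asymptotics.
Variable R : realType.

Lemma near_ln_ge (A : R) : \forall n \near \oo, A <= ln (n%:R : R).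
Proof.
near=> n; have h : expR A <= n%:R by near: n; exact: nbhs_infty_ger.
by rewrite -(expRK A) ler_ln ?posrE ?expR_gt0 // (lt_le_trans _ h) ?expR_gt0.
Unshelve. all: by end_near. Qed.

(** With [l = ln x >= 16 c], one has [c l <= l^2 / 16], while [x = exp l >= l^2 / 2]. *)
Lemma mul_ln_le (c x : R) : 0 <= c -> expR (16 * c) <= x -> c * ln x <= x / 8.
Proof.
move=> c0 hx; have x0 : 0 < x by apply: lt_le_trans hx; exact: expR_gt0.
have l16 : 16 * c <= ln x by rewrite -(expRK (16 * c)) ler_ln ?posrE ?expR_gt0.
have l0 : 0 <= ln x by apply: le_trans l16; rewrite mulr_ge0.
have := expR_ge1Dxn 1 l0; rewrite lnK ?posrE // (_ : (2`!)%:R = 2 :> R) // => h.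
have : 16 * c * ln x <= ln x * ln x by apply: ler_wpM2r.
by rewrite expr2 in h; lra.
Qed.

(** The cubic term [x^3 / 6] of the exponential suffices, since [e x / 6 >= 25]. *)
Lemma sqr_le_expR (e x : R) : 0 < e -> 0 <= x -> 150 / e <= x ->
  25 * x ^+ 2 <= e * expR x.
Proof.
move=> e0 x0 hx; have := expR_ge1Dxn 2 x0.
rewrite (_ : (3`!)%:R = 6 :> R) // => h.
have h1 : 150 <= e * x by rewrite mulrC -ler_pdivrMr.
apply: (@le_trans _ _ (e * (x ^+ 3 / 6))); last by rewrite ler_pM2l //; lra.
have -> : e * (x ^+ 3 / 6) = (e * x) / 6 * x ^+ 2 by ring.
by apply: ler_wpM2r; rewrite ?sqr_ge0 //; lra.
Qed.

Lemma expR_mul_le (C e x : R) : 0 < C -> 0 < e -> x <= ln (e / C) -> C * expR x <= e.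
Proof.
move=> C0 e0 hx; rewrite -ler_pdivlMl // mulrC.
by rewrite -[leRHS]lnK ?posrE ?divr_gt0 // ler_expR.
Qed.

Lemma rig_robust_prob_bounds (k n P : nat) (D : size_distr R P) :
  0 <= rig_robust_prob k n D <= 1.
Proof.
have mu1 := sum_objset_prob D; have mu0 := objset_prob_ge0 D.
rewrite /rig_robust_prob rig_probE pE_indic_le1 // andbT.
by rewrite -(@pE_cst R 'I_n _ (objset_prob D) 0 mu1); apply: le_pE.
Qed.

End Asymptotics.

Theorem theorem4 (R : realType) (k : nat) (hk : (0 < k)%N)
    (P : nat -> nat) (hP : forall n, (0 < P n)%N)
    (D : forall n, size_distr R (P n))
    (alpha : nat -> R)
    (halpha : forall n, (1 < n)%N ->
       size_mean (D n) ^+ 2 / (P n)%:R =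
       (ln n%:R + (k%:R - 1) * ln (ln n%:R) + alpha n) / n%:R)
    (hmean : (fun n => size_mean (D n) : R^o) =Omega_\oo
             (fun n => ln n%:R ^+ 3 : R^o))
    (hvar : (fun n => size_var (D n) : R^o) =o_\oo
            (fun n => size_mean (D n) ^+ 2 / (n%:R * ln n%:R ^+ 2) : R^o))
    (hsmall : (fun n => `|alpha n| : R^o) =o_\oo (fun n => ln n%:R : R^o)) :
  (alpha n @[n --> \oo] --> -oo ->
     rig_robust_prob k n (D n) @[n --> \oo] --> (0 : R)) /\
  (alpha n @[n --> \oo] --> +oo ->
     rig_robust_prob k n (D n) @[n --> \oo] --> (1 : R)).
Proof.
case: k hk halpha => // K _ halpha.
have [c c0 mean_ge] : exists2 c : R, 0 < c &
    \forall n \near \oo, c * ln n%:R ^+ 3 <= size_mean (D n).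
  move: hmean; rewrite eqOmegaE qualifE => /asboolP[c c0 hc]; exists c => //.
  have mean0 n : 0 <= size_mean (D n).
    by apply: sumr_ge0 => s _; rewrite mulr_ge0 // Defs.pmf_ge0.
  near=> n; rewrite -[leRHS]ger0_norm // -[X in c * X]ger0_norm; last first.
    by rewrite exprn_ge0 // ln_ge0 // ler1n; near: n; exact: nbhs_infty_gt.
  by near: n.
have var_le e : 0 < e -> \forall n \near \oo,
    size_var (D n) <= e * (size_mean (D n) ^+ 2 / (n%:R * ln n%:R ^+ 2)).
  move=> e0; move/eqoP: hvar => /(_ e e0) h; near=> n.
  have : `|size_var (D n)| <= e * `|size_mean (D n) ^+ 2 / (n%:R * ln n%:R ^+ 2)| by near: n.
  rewrite ger0_norm; last by apply: sumr_ge0 => s _; rewrite mulr_ge0 ?sqr_ge0 ?Defs.pmf_ge0.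
  rewrite ger0_norm //; apply: divr_ge0; first exact: sqr_ge0.
  by apply: mulr_ge0 => //; exact: sqr_ge0.
have alpha_le : \forall n \near \oo, `|alpha n| <= ln (n%:R : R) / 8.
  move/eqoP: hsmall => /(_ 8^-1) h; near=> n.
  have : `|(`|alpha n|)| <= 8^-1 * `|ln (n%:R : R)| by near: n; apply: h; rewrite invr_gt0.
  rewrite normr_id mulrC [X in X / _]ger0_norm // ln_ge0 // ler1n.
  by near: n; exact: nbhs_infty_gt.
have mean_eq n : (1 < n)%N -> size_mean (D n) ^+ 2 / (P n)%:R =
    (ln n%:R + K%:R * ln (ln n%:R) + alpha n) / n%:R.
  by move=> n1; rewrite halpha // -natr1 addrK.
(* Capping the accuracy ensures [tau <= 1], as both regime lemmas require. *)
pose ep (e : R) := Num.min e (14 + 6 * K%:R)^-1.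
have K14 : 0 < 14 + 6 * K%:R :> R by rewrite ltr_wpDr // mulr_ge0.
have ep0 e : 0 < e -> 0 < ep e by move=> e0; rewrite lt_min e0 invr_gt0.
have epe e : ep e <= e by rewrite ge_min lexx.
have ep14 e : (14 + 6 * K%:R) * ep e <= 1.
  by rewrite mulrC -ler_pdivlMr // mul1r ge_min lexx orbT.
pose bounds e n :=
    (expR 4 * 2 ^+ K * expR (- alpha n) <= ep e ->
       1 - 4 * ep e <= rig_robust_prob K.+1 n (D n)) /\
    (2 ^+ K.+1 * K`!%:R * expR (alpha n) <= ep e ->
       rig_robust_prob K.+1 n (D n) <= (79 + 30 * K%:R) * ep e).
have bounds_near e : 0 < e -> \forall n \near \oo, bounds e n.
  move=> /ep0 e0; have e3 : 0 < ep e ^+ 3 by rewrite exprn_gt0.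
  have var1 := var_le _ e3; near=> n.
  have n2 : (2 <= n)%N by near: n; exact: nbhs_infty_ge.
  have L1 : expR (16 * K%:R) <= ln (n%:R : R) by near: n; exact: near_ln_ge.
  have L2 : 150 / ep e <= ln (n%:R : R) by near: n; exact: near_ln_ge.
  have L3 : 30 + 3 * K%:R <= ln (n%:R : R) by near: n; exact: near_ln_ge.
  have L4 : (50 + 5 * K%:R) / (c * ep e ^+ 2) <= ln (n%:R : R).
    by near: n; exact: near_ln_ge.
  have mean_n : c * ln n%:R ^+ 3 <= size_mean (D n) by near: n.
  have var_n : size_var (D n) <=
      ep e ^+ 3 * (size_mean (D n) ^+ 2 / (n%:R * ln n%:R ^+ 2)) by near: n.
  have alpha_n : `|alpha n| <= ln (n%:R : R) / 8 by near: n.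
  have lnL := mul_ln_le (ler0n R K) L1.
  have cL : 50 + 5 * K%:R <= c * ep e ^+ 2 * ln n%:R.
    by rewrite [leRHS]mulrC -ler_pdivrMr // mulr_gt0 // exprn_gt0.
  have nL : 25 * ln n%:R ^+ 2 <= ep e * n%:R.
    have n0 : 0 < n%:R :> R by rewrite ltr0n (leq_trans _ n2).
    rewrite -[X in _ <= _ * X]lnK ?posrE //; apply: sqr_le_expR => //.
    by rewrite ln_ge0 // ler1n (leq_trans _ n2).
  split=> ha.
    exact: regime_not_robust_le (mean_eq _ n2) mean_n var_n alpha_n lnL _ cL nL ha.
  exact: regime_robust_le (mean_eq _ n2) mean_n var_n alpha_n lnL _ cL nL ha.
split => [alpha_Ny | alpha_y]; apply/cvgrPdist_le => e e0.
- have K79 : 0 < 79 + 30 * K%:R :> R by rewrite ltr_wpDr // mulr_ge0.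
  (* Scaled so that the constant of [regime_robust_le] brings the bound back to [e]. *)
  pose e1 := e / (79 + 30 * K%:R).
  have e10 : 0 < e1 by rewrite divr_gt0.
  have alpha1 := (cvgrNyPle _).1 alpha_Ny (ln (ep e1 / (2 ^+ K.+1 * K`!%:R))).
  near=> n; have [_ robust_n] : bounds e1 n by near: n; exact: bounds_near.
  have /andP[p0 _] := rig_robust_prob_bounds K.+1 n (D n).
  rewrite sub0r normrN ger0_norm //; apply: le_trans (robust_n _) _.
    apply: expR_mul_le; [|exact: ep0|by near: n; exact: alpha1].
    by rewrite mulr_gt0 ?exprn_gt0 // ltr0n fact_gt0.
  by rewrite mulrC -ler_pdivlMr.
- have e10 : 0 < e / 4 by rewrite divr_gt0.
  (* Beyond this threshold the failure term [expR 4 * 2 ^+ K * expR (- alpha n)] is at most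
     [ep (e / 4)]. *)
  have alpha1 := (cvgryPge _).1 alpha_y (- ln (ep (e / 4) / (expR 4 * 2 ^+ K))).
  near=> n; have [robust_n _] : bounds (e / 4) n by near: n; exact: bounds_near.
  have /andP[_ p1] := rig_robust_prob_bounds K.+1 n (D n).
  rewrite ger0_norm ?subr_ge0 // lerBlDr addrC -lerBlDr.
  apply: le_trans (robust_n _); first by rewrite lerB // mulrC -ler_pdivlMr.
  apply: expR_mul_le; [|exact: ep0|by rewrite lerNl; near: n; exact: alpha1].
  by rewrite mulr_gt0 ?exprn_gt0 ?expR_gt0.
Unshelve. all: by end_near. Qed.
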